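(* Let $n \ge 2$ and let $\Omega \subset \mathbb{R}^n$ be a $BV$-extension domain. Then the set $\mathcal{T}_\Omega$ of two-sided boundary points of $\Omega$ satisfies $$ \dim_{\mathcal H}(\mathcal{T}_\Omega) \le n-1, $$ where $\dim_{\mathcal H}$ denotes Hausdorff dimension.
   Context: A domain is a nonempty connected open subset of $\mathbb{R}^n$. For a domain $\Omega\subset\mathbb{R}^n$, $BV(\Omega)=\{u\in L^1(\Omega): \|Du\|(\Omega)<\infty\}$, where $\|Du\|(\Omega)=\sup\{\int_\Omega u\,\mathrm{div}(v)\,dx : v\in C_0^\infty(\Omega;\mathbb{R}^n),\ |v|\le 1\}$ is the total variation, and $\|u\|_{BV(\Omega)}=\|u\|_{L^1(\Omega)}+\|Du\|(\Omega)$. $\Omega$ is a $BV$-extension domain if there exist a constant $C>0$ and a (not necessarily linear) operator $T\colon BV(\Omega)\to BV(\mathbb{R}^n)$ such that $Tu|_\Omega=u$ and $\|Tu\|_{BV(\mathbb{R}^n)}\le C\|u\|_{BV(\Omega)}$ for all $u\in BV(\Omega)$. A point $x\in\partial\Omega$ is called two-sided if there exists $R>0$ such that for all $r\in(0,R)$ there exist disjoint connected components $\Omega_r^1$ and $\Omega_r^2$ of $\Omega\cap B(x,r)$ that are nested: $\Omega_s^i\subset\Omega_r^i$ for $0<s<r<R$ and $i\in\{1,2\}$. The set of two-sided points of $\partial\Omega$ is denoted $\mathcal{T}_\Omega$. *)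

(* Defs.v *)
From HB Require Import structures.
From mathcomp Require Import all_boot all_order all_algebra.
From mathcomp Require Import all_classical all_reals all_analysis.
From mathcomp Require Import measurable_realfun.

Set Implicit Arguments.
Unset Strict Implicit.
Unset Printing Implicit Defensive.

Import Order.TTheory GRing.Theory Num.Theory.
Import numFieldNormedType.Exports.

Local Open Scope classical_set_scope.
Local Open Scope ring_scope.

Definition rV_display : measure_display. Proof. exact. Qed.

(* The sigma-algebra generated by the coordinate maps; [measurable_rVE] below
   shows that it is the Borel sigma-algebra. *)
Section rV_measurable.
Context {R : realType}.
Variable n : nat.

Let coor (i : 'I_n) (x : 'rV[R]_n) : measurableTypeR R := x ord0 i.

Let rV_set0 : g_sigma_preimage coor set0.
Proof. exact: sigma_algebra0. Qed.

Let rV_setC A : g_sigma_preimage coor A -> g_sigma_preimage coor (~` A).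
Proof. exact: sigma_algebraC. Qed.

Let rV_bigcup (F : (set 'rV[R]_n)^nat) :
  (forall i, g_sigma_preimage coor (F i)) ->
  g_sigma_preimage coor (\bigcup_i (F i)).
Proof. exact: sigma_algebra_bigcup. Qed.

HB.instance Definition _ := @isMeasurable.Build rV_display
  'rV[R]_n (g_sigma_preimage coor) rV_set0 rV_setC rV_bigcup.

Lemma measurable_coor (i : 'I_n) :
  measurable_fun setT (fun x : 'rV[R]_n => x ord0 i : measurableTypeR R).
Proof.
move=> _ Y mY; rewrite setTI; apply: sub_sigma_algebra => /=.
rewrite -bigcup_seq/=; exists i => /=; first by rewrite mem_index_enum.
by exists Y => //; rewrite setTI.
Qed.

Lemma measurable_fun_rV d (T : measurableType d) (f : T -> 'rV[R]_n) :
  (forall i, measurable_fun setT (fun t => f t ord0 i : measurableTypeR R)) ->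
  measurable_fun setT f.
Proof.
move=> mf.
suff : g_sigma_preimage (fun i => coor i \o f) `<=` measurable.
  move=> h _ A mA; apply: h; rewrite g_sigma_preimage_comp.
  by exists A.
apply: smallest_sub; first exact: sigma_algebra_measurable.
move=> A; rewrite -bigcup_seq => -[i _ [B mB <-]].
exact: mf.
Qed.

End rV_measurable.

Lemma measurable_rVE {R : realType} n :
  @measurable _ 'rV[R]_n = <<s [set U | open U] >>.
Proof.
apply/seteqP; split.
  apply: smallest_sub; first exact: smallest_sigma_algebra.
  move=> A; rewrite -bigcup_seq => -[i _ [B mB <-]]; rewrite setTI.
  have : preimage_set_system setT (fun x : 'rV[R]_n => x ord0 i)
      (<<s [set U : set R | open U] >>) `<=` <<s [set U | open U] >>.
    rewrite -g_sigma_preimageE; apply: smallest_sub.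
      exact: smallest_sigma_algebra.
    move=> _ [V oV <-]; rewrite setTI; apply: sub_sigma_algebra => /=.
    by move/continuousP: (@coord_continuous R 1 n ord0 i); exact.
  apply; exists B; last by rewrite setTI.
  have : (@RGenOpens.G R).-sigma.-measurable B by rewrite -RGenOpens.measurableE.
  apply: smallest_sub; first exact: smallest_sigma_algebra.
  move=> _ [a [b ->]]; apply: sub_sigma_algebra; exact: interval_open.
apply: smallest_sub; first exact: sigma_algebra_measurable.
move=> U /= oU.
pose B (p : 'rV[rat]_n * nat) := [set x : 'rV[R]_n |
  forall i, ball (ratr (p.1 ord0 i) : R) p.2.+1%:R^-1 (x ord0 i)].
have mB p : measurable (B p).
  rewrite (_ : B p = \bigcap_(i in [set: 'I_n])
    ((fun x : 'rV[R]_n => x ord0 i : measurableTypeR R) @^-1`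
      ball (ratr (p.1 ord0 i) : R) p.2.+1%:R^-1)).
    apply: fin_bigcap_measurable => // i _.
    rewrite -[X in measurable X]setTI; apply: measurable_coor => //.
    exact: measurable_ball.
  by apply/seteqP; split => x /= Ax i; [move=> _|]; exact: Ax.
pose F m := if unpickle m is Some p then
  if `[< B p `<=` U >] then B p else set0 else set0.
rewrite (_ : U = \bigcup_m F m); last first.
  apply/seteqP; split => [x Ux|x [m _]]; last first.
    by rewrite /F; case: unpickle => // p; case: asboolP => // + Bx; exact.
  have /nbhs_ballP[e /= e0 xeU] := open_nbhs_nbhs (conj oU Ux).
  have [k ke] : exists k, k.+1%:R^-1 < e / 2.
    have [k _ /(_ k (leqnn k)) /= ] := near_infty_natSinv_lt (PosNum (divr_gt0 e0 (ltr0n R 2))).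
    by exists k.
  have k0 : 0 < k.+1%:R^-1 :> R by rewrite invr_gt0.
  have /choice[q qP] (i : 'I_n) : exists q : rat, ball (ratr q : R) k.+1%:R^-1 (x ord0 i).
    have [|q] := @rat_in_itvoo R (x ord0 i - k.+1%:R^-1) (x ord0 i + k.+1%:R^-1).
      by rewrite ltrD2l gtrN.
    by move=> qx; exists q; apply: ball_sym; rewrite ball_itv.
  exists (pickle (\row_i q i, k)) => //.
  rewrite /F pickleK; case: asboolP => [_ i|[]] /=; first by rewrite mxE; exact: qP.
  move=> y By; apply: xeU; split => // i j; rewrite [i]ord1.
  rewrite (splitr e); apply: (@ball_triangle _ _ (ratr (q j) : R)).
    by apply: ball_sym; apply: le_ball (qP j); exact: ltW.
  by have := By j; rewrite mxE; apply: le_ball; exact: ltW.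
apply: bigcupT_measurable => m; rewrite /F.
by case: unpickle => // p; case: ifP.
Qed.

Section lebesgue_rV.
Context {R : realType}.

Definition rV_cons n (p : measurableTypeR R * 'rV[R]_n) : 'rV[R]_n.+1 :=
  \row_i (if unlift ord0 i is Some j then p.2 ord0 j else p.1).

Lemma rV_cons0 n p : @rV_cons n p ord0 ord0 = p.1.
Proof. by rewrite mxE unlift_none. Qed.

Lemma rV_consS n p i : @rV_cons n p ord0 (lift ord0 i) = p.2 ord0 i.
Proof. by rewrite mxE liftK. Qed.

Lemma measurable_rV_cons n : measurable_fun setT (@rV_cons n).
Proof.
apply: measurable_fun_rV => i.
have [j ->|->] := unliftP ord0 i.
  rewrite (_ : (fun _ => _) = (fun x : 'rV[R]_n => x ord0 j) \o snd); last first.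
    by apply/funext => p /=; rewrite rV_consS.
  apply: measurableT_comp; last exact: measurable_snd.
  exact: measurable_coor.
rewrite (_ : (fun _ => _) = fst); last by apply/funext => p; rewrite rV_cons0.
exact: measurable_fst.
Qed.

HB.instance Definition _ n :=
  isMeasurableFun.Build _ _ _ _ (@rV_cons n) (@measurable_rV_cons n).

Section cons_measure.
Local Open Scope ereal_scope.
Variables (n : nat) (mu : {sigma_finite_measure set 'rV[R]_n -> \bar R}).

Definition cons_measure : set 'rV[R]_n.+1 -> \bar R :=
  pushforward (@lebesgue_measure R \x mu) (@rV_cons n).

Let cons0 : cons_measure set0 = 0.
Proof. exact: measure0. Qed.

Let cons_ge0 A : 0 <= cons_measure A.
Proof. exact: measure_ge0. Qed.

Let cons_sigma_additive : semi_sigma_additive cons_measure.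
Proof. exact: measure_semi_sigma_additive. Qed.

HB.instance Definition _ := isMeasure.Build _ _ _ cons_measure
  cons0 cons_ge0 cons_sigma_additive.

Let cons_sigma_finite : sigma_finite setT cons_measure.
Proof.
have [F FT Foo] : sigma_finite setT (@lebesgue_measure R \x mu).
  have /sigma_finiteP[F [TF ndF Foo]] := sigma_finiteT (@lebesgue_measure R).
  have /sigma_finiteP[G [TG ndG Goo]] := sigma_finiteT mu.
  exists (fun k => F k `*` G k).
    rewrite -setXTT TF TG; apply/seteqP; split => -[x y]; last first.
      by move=> [k _ []/= Fx Gy]; split; exists k.
    move=> [/= [i _ Fx] [j _ Gy]]; exists (maxn i j) => //; split.
      by move: x Fx; exact/subsetPset/ndF/leq_maxl.
    by move: y Gy; exact/subsetPset/ndG/leq_maxr.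
  move=> k; have [mF Fk] := Foo k; have [mG Gk] := Goo k.
  split; first exact: measurableX.
  by rewrite product_measure1E// lte_mul_pinfty// ge0_fin_numE.
pose p (x : 'rV[R]_n.+1) : measurableTypeR R * 'rV[R]_n :=
  (x ord0 ord0, \row_i x ord0 (lift ord0 i)).
have pK : cancel (@rV_cons n) p.
  move=> [a y]; rewrite /p rV_cons0; congr pair.
  by apply/rowP => i; rewrite mxE rV_consS.
have mp : measurable_fun setT p.
  apply/measurable_fun_pair; first exact: measurable_coor.
  apply: measurable_fun_rV => i; under eq_fun do rewrite mxE.
  exact: measurable_coor.
exists (fun i => p @^-1` F i).
  by rewrite -preimage_bigcup -FT preimage_setT.
move=> i; have [mFi Fioo] := Foo i; split.
  by rewrite -[X in measurable X]setTI; exact: mp.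
rewrite /cons_measure /pushforward -comp_preimage.
by rewrite (_ : p \o _ = id) ?preimage_id//; apply/funext => x /=; rewrite pK.
Qed.

HB.instance Definition _ := Measure_isSigmaFinite.Build _ _ _ cons_measure
  cons_sigma_finite.
End cons_measure.

(* [lebesgue_rV n.+1] is the image of the product of the Lebesgue measure on [R]
   with [lebesgue_rV n]; see [lebesgue_rV_prod] for its values on products. *)
Fixpoint lebesgue_rV n : {sigma_finite_measure set 'rV[R]_n -> \bar R} :=
  if n is n'.+1 then cons_measure (lebesgue_rV n')
  else \d_(0 : 'rV[R]_0).

Lemma lebesgue_rV_prod n (A : 'I_n -> set (measurableTypeR R)) :
  (forall i, measurable (A i)) ->
  lebesgue_rV n [set x | forall i, A i (x ord0 i)] =
  (\prod_(i < n) lebesgue_measure (A i))%E.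
Proof.
elim: n A => [|n IH] A mA.
  by rewrite big_ord0 /= diracE mem_set//= => -[].
have mB : measurable [set x : 'rV[R]_n | forall i, A (lift ord0 i) (x ord0 i)].
  rewrite (_ : mkset _ = \bigcap_(i in [set: 'I_n])
    ((fun x : 'rV[R]_n => x ord0 i : measurableTypeR R) @^-1` A (lift ord0 i))).
    apply: fin_bigcap_measurable => // i _.
    by rewrite -[X in measurable X]setTI; exact: measurable_coor.
  by apply/seteqP; split => x /= Ax i; [move=> _|]; exact: Ax.
rewrite big_ord_recl -IH// -product_measure1E//.
rewrite /= /cons_measure /pushforward; congr (_ _).
apply/seteqP; split => -[a y] /=.
  move=> Aay; split; first by have := Aay ord0; rewrite rV_cons0.
  by move=> i; have := Aay (lift ord0 i); rewrite rV_consS.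
move=> [/= Aa Ay] i; have [j ->|->] := unliftP ord0 i.
  by rewrite rV_consS; exact: Ay.
by rewrite rV_cons0.
Qed.

End lebesgue_rV.
Arguments lebesgue_rV {R} n.

(* The norm [`|x|] of ['rV[R]_n] is the sup norm: it induces the same topology
   as [enorm], but its balls are cubes and its diameters differ. *)
Section euclidean.
Context {R : realType} {n : nat}.
Implicit Types (x y : 'rV[R]_n) (A : set 'rV[R]_n).

Definition enorm x : R := Num.sqrt (\sum_(i < n) x ord0 i ^+ 2).

Definition eball x (r : R) : set 'rV[R]_n := [set y | enorm (y - x) < r].

(* [0%:E] is adjoined so that the diameter of the empty set is 0. *)
Definition ediam A : \bar R :=
  ereal_sup [set z | z = 0%E \/
    exists x y, [/\ A x, A y & z = (enorm (x - y))%:E]].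

Definition boundary A : set 'rV[R]_n := closure A `\` A°.

Definition is_domain A := [/\ A !=set0, open A & connected A].

End euclidean.

Section BV.
Context {R : realType} {n : nat}.
Implicit Types (Omega : set 'rV[R]_n) (u : 'rV[R]_n -> R).

Let mu := @lebesgue_rV R n.

Definition partial (i : 'I_n) (f : 'rV[R]_n -> R) : 'rV[R]_n -> R :=
  fun x => 'D_(delta_mx ord0 i) f x.

Definition iter_partial (s : seq 'I_n) (f : 'rV[R]_n -> R) : 'rV[R]_n -> R :=
  foldr partial f s.

(* [C^oo]: all iterated partial derivatives exist and are continuous; the
   derivability clause is needed since ['D_v f] is total. *)
Definition smooth (f : 'rV[R]_n -> R) := forall s : seq 'I_n,
  continuous (iter_partial s f) /\
  forall (i : 'I_n) (x : 'rV[R]_n),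
    derivable (iter_partial s f) x (delta_mx ord0 i).

Definition divergence (v : 'rV[R]_n -> 'rV[R]_n) (x : 'rV[R]_n) : R :=
  \sum_(i < n) partial i (fun y => v y ord0 i) x.

(* [C_0^oo(Omega; R^n)], each field being extended by 0 outside [Omega]. *)
Definition test_field Omega (v : 'rV[R]_n -> 'rV[R]_n) :=
  [/\ forall i : 'I_n, smooth (fun x => v x ord0 i),
      compact (closure [set x | v x != 0]) &
      closure [set x | v x != 0] `<=` Omega].

Definition total_variation u Omega : \bar R :=
  ereal_sup [set (\int[mu]_(x in Omega) (u x * divergence v x)%:E)%E |
    v in [set v | test_field Omega v /\ forall x, enorm (v x) <= 1]].

(* A function on [Omega] is represented by a function on [R^n] whose values
   outside [Omega] are irrelevant. *)
Definition BV Omega u :=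
  mu.-integrable Omega (EFin \o u) /\ (total_variation u Omega < +oo)%E.

Definition BV_norm Omega u : \bar R :=
  ((\int[mu]_(x in Omega) `|u x|%:E) + total_variation u Omega)%E.

(* Elements of [BV] are classes of functions modulo equality almost everywhere:
   the second condition says that [T] is well defined on classes. *)
Definition BV_extension_domain Omega :=
  is_domain Omega /\
  exists (C : R) (T : ('rV[R]_n -> R) -> 'rV[R]_n -> R), [/\ 0 < C,
    forall u w, BV Omega u -> BV Omega w ->
      ae_eq mu Omega u w -> ae_eq mu setT (T u) (T w) &
    forall u, BV Omega u ->
      [/\ BV setT (T u), ae_eq mu Omega (T u) u &
          (BV_norm setT (T u) <= C%:E * BV_norm Omega u)%E]].

End BV.

Section two_sided.
Context {R : realType} {n : nat}.
Implicit Types (Omega A C : set 'rV[R]_n).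

Definition is_component A C := exists2 x, A x & C = connected_component A x.

Definition two_sided Omega : set 'rV[R]_n := [set x | boundary Omega x /\
  exists (r0 : R) (Om1 Om2 : R -> set 'rV[R]_n), [/\ 0 < r0,
    forall r, 0 < r < r0 ->
      [/\ is_component (Omega `&` eball x r) (Om1 r),
          is_component (Omega `&` eball x r) (Om2 r) &
          Om1 r `&` Om2 r = set0] &
    forall s r, 0 < s -> s < r -> r < r0 ->
      Om1 s `<=` Om1 r /\ Om2 s `<=` Om2 r]].

End two_sided.

Section hausdorff.
Context {R : realType} {n : nat}.
Implicit Types (A E : set 'rV[R]_n).
Local Open Scope ereal_scope.

(* [diam(E)^s] with the convention that the empty set contributes 0, also when
   [s = 0]. *)
Definition diam_pow (s : R) E : \bar R :=
  if E == set0 then 0 else ediam E `^ s.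

Definition hausdorff_premeasure (s delta : R) A : \bar R :=
  ereal_inf [set \sum_(k <oo) diam_pow s (E k) |
    E in [set E : (set 'rV[R]_n)^nat |
      A `<=` \bigcup_k E k /\ forall k, ediam (E k) <= delta%:E]].

Definition hausdorff_measure (s : R) A : \bar R :=
  ereal_sup [set hausdorff_premeasure s delta A | delta in [set d : R | (0 < d)%R]].

Definition hausdorff_dim A : \bar R :=
  ereal_inf [set s%:E | s in [set s : R | (0 <= s)%R /\ hausdorff_measure s A = 0]].

End hausdorff.

(* Main.v *)
(** A function [w] of bounded variation equal to 1 on an open set [E] satisfies
    [|E|^(n-1) <= (C |Dw|(R^n))^n], and one equal to 1 on [E1] and to 0 on [E2],
    both in a cube of side [L] and of volume at least [a], satisfies
    [a <= C L |Dw|(cube)].  Both are proved by testing [w] against the divergence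
    of explicit fields which move a smoothed density of [E] through the dyadic
    scales, from each cube to its parent; each such jump costs the side of the
    cube times the size of the density, and the costs form a geometric series.

    Let [D] be a component of the intersection of [Omega] with a cube, [x] a
    point of its closure. Cutting off the indicator function of [D] near [x] and
    extending it, the first inequality gives
    [|D n B(x,t)|^(n-1) <= (C |D n B(x,s)| / (s-t))^n] for [t < s], and De
    Giorgi's iteration turns this into the density bound
    [|D n B(x,s)| >= c s^n].  If [x] is in the closure of two such components
    [D1] and [D2], the second inequality shows that the extension [w] of one
    fixed cut-off of the indicator of [D1] has [|Dw|(B(x,s)) >= c s^(n-1)] for all
    small [s].  As [|Dw|] is superadditive, the set of these points contains at
    most [C s^(1-n)] points at mutual distance [2s], so that it is null for the
    Hausdorff measures of exponent larger than [n-1].  Countably many pairs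
    [(D1, D2)] account for all two-sided points, because the cubes can be taken
    with rational data. *)
From mathcomp Require Import all_boot all_order all_algebra.
From mathcomp Require Import all_classical all_reals all_analysis.
From mathcomp Require Import measurable_realfun ring lra.
Require Import Defs.

Set Implicit Arguments.
Unset Strict Implicit.
Unset Printing Implicit Defensive.

Import Order.TTheory GRing.Theory Num.Theory.
Import numFieldNormedType.Exports.

Local Open Scope classical_set_scope.
Local Open Scope ring_scope.

(** * Smooth functions on the line *)

(** [total_variation] is a supremum over test fields, so a lower bound for it needs an explicit
    field. The basic fields have components that are products of functions of one variable, which
    makes smoothness and divergence computable factor by factor. The part of [E] in a cube of side l
    has volume at most min(|E|, l^n), and the field moving it has size volume / l^(n-1). Below the
    scale r = |E|^(1/n) this is at most l; above it, at most r^n / l^(n-1), which for n >= 2 still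
    decays geometrically as l grows. The total is of order r: this is where the exponents of the
    isoperimetric inequality come from. Inside [Omega] the indicator function of [D] can jump only
    on the boundary of the cube, where the cut-off vanishes. Hence the variation of the cut-off in
    [Omega] is at most a volume over s - t, however irregular the boundary of [Omega] is.
    Superadditivity concerns a single function, so the [w] of the last step must not depend on the
    boundary point. It comes from a cut-off centred at the centre of the cube and equal to 1 on [D]
    in the concentric cube of half the size; the points considered stay in the quarter-size cube. *)

Section smooth_line.
Context {R : realType}.
Implicit Types f g : R -> R.

Let scalerE (a b : R) : a *: (b : R^o) = a * b. Proof. by []. Qed.

(** [derive1] is total, so derivability is required separately at each order. Counting the orders
    lets the product and inverse rules, which mix a function with its derivative, be proved by
    induction through [derivable_uptoW]. *)
Fixpoint derivable_upto (k : nat) f : Prop :=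
  if k is k'.+1 then
    (forall t, derivable f t 1) /\ derivable_upto k' (derive1 f)
  else True.

Definition smooth1 f := forall k, derivable_upto k f.

Lemma smooth1_derivable f t : smooth1 f -> derivable f t 1.
Proof. by move=> /(_ 1)[]. Qed.

Lemma smooth1_derive1 f : smooth1 f -> smooth1 (derive1 f).
Proof. by move=> sf k; have [] := sf k.+1. Qed.

Lemma derivable_continuous1 f : (forall t, derivable f t 1) -> continuous f.
Proof. by move=> df t; apply/differentiable_continuous/derivable1_diffP. Qed.

Lemma smooth1_continuous f : smooth1 f -> continuous f.
Proof.
by move=> sf; apply: derivable_continuous1 => t; exact: smooth1_derivable.
Qed.

Lemma derivable_uptoW k f : derivable_upto k.+1 f -> derivable_upto k f.
Proof.
by elim: k f => //= k IH f [df [ddf dddf]]; split=> //; exact: IH.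
Qed.

Lemma derivable_uptoD k f g : derivable_upto k f -> derivable_upto k g ->
  derivable_upto k (f \+ g).
Proof.
elim: k f g => //= k IH f g [df sf] [dg sg]; split.
  by move=> t; apply: derivableD.
rewrite (_ : derive1 _ = derive1 f \+ derive1 g); first exact: IH.
by apply/funext => t /=; rewrite !derive1E deriveD.
Qed.

Lemma derivable_uptoM k f g : derivable_upto k f -> derivable_upto k g ->
  derivable_upto k (f \* g).
Proof.
elim: k f g => //= k IH f g [df sf] [dg sg]; split.
  by move=> t; apply: derivableM.
rewrite (_ : derive1 _ = (f \* derive1 g) \+ (g \* derive1 f)).
  by apply: derivable_uptoD; apply: IH; [exact: derivable_uptoW| |exact: derivable_uptoW|].
by apply/funext => t /=; rewrite !derive1E deriveM.
Qed.

Lemma derivable_upto_cst k (c : R) : derivable_upto k (cst c).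
Proof.
elim: k c => //= k IH c; split; first by move=> t; exact: derivable_cst.
rewrite (_ : derive1 _ = cst 0); first exact: IH.
by apply/funext => t; rewrite derive1_cst.
Qed.

Lemma derivable_uptoV k f : (forall t, f t != 0) -> derivable_upto k f ->
  derivable_upto k (fun t => (f t)^-1).
Proof.
move=> f0; elim: k => //= k IH [df sf]; split.
  by move=> t; apply: derivableV.
rewrite (_ : derive1 _ = cst (- 1) \* (((fun t => (f t)^-1) \* (fun t => (f t)^-1))
   \* derive1 f)); last first.
  apply/funext => t /=; rewrite !derive1E deriveV// scalerE.
  by rewrite mulN1r mulNr expr2 invfM.
have sV : derivable_upto k (fun t => (f t)^-1).
  by apply: IH; exact: derivable_uptoW.
by do ![apply: derivable_uptoM => //]; exact: derivable_upto_cst.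
Qed.

Lemma is_derive_inv f (t df : R) : f t != 0 -> is_derive t (1 : R) f df ->
  is_derive t (1 : R) (fun x => (f x)^-1) (- (f t) ^- 2 * df).
Proof.
move=> f0 [df1 df2]; apply: DeriveDef; first exact: derivableV.
by rewrite deriveV// df2.
Qed.

Lemma is_derive_affine f (c d t : R) : derivable f (c * t + d) 1 ->
  is_derive t (1 : R) (fun t => f (c * t + d)) (c * derive1 f (c * t + d)).
Proof.
move=> df; rewrite mulrC derive1E.
apply: (@is_derive1_comp _ f (fun t => c * t + d)); first exact: derivableP.
have lim : h^-1 *: (((fun t => c * t + d) \o shift t) (h *: (1 : R)) - (c * t + d))
    @[h --> (0 : R)^'] --> c.
  apply: cvg_near_cst; near=> h.
  have h0 : h != 0 by near: h; exact: nbhs_dnbhs_neq.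
  by rewrite /= !scalerE mulr1; field; exact: h0.
by apply: DeriveDef; [apply/cvg_ex; exists c|exact: cvg_lim lim].
Unshelve. all: by end_near. Qed.

Lemma derivable_upto_affine k f (c d : R) : derivable_upto k f ->
  derivable_upto k (fun t => f (c * t + d)).
Proof.
elim: k f => //= k IH f [df sf]; split.
  by move=> t; have [] := is_derive_affine (df (c * t + d)).
rewrite (_ : derive1 _ = cst c \* (fun t => derive1 f (c * t + d))).
  by apply: derivable_uptoM; [exact: derivable_upto_cst|exact: IH].
apply/funext => t /=; rewrite derive1E.
by have := is_derive_affine (df (c * t + d)) => /@derive_val ->.
Qed.

Lemma smooth1D f g : smooth1 f -> smooth1 g -> smooth1 (f \+ g).
Proof. by move=> sf sg k; exact: derivable_uptoD. Qed.

Lemma smooth1M f g : smooth1 f -> smooth1 g -> smooth1 (f \* g).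
Proof. by move=> sf sg k; exact: derivable_uptoM. Qed.

Lemma smooth1_cst c : smooth1 (cst c).
Proof. by move=> k; exact: derivable_upto_cst. Qed.

Lemma smooth1V f : (forall t, f t != 0) -> smooth1 f ->
  smooth1 (fun t => (f t)^-1).
Proof. by move=> f0 sf k; exact: derivable_uptoV. Qed.

Lemma smooth1_affine f c d : smooth1 f -> smooth1 (fun t => f (c * t + d)).
Proof. by move=> sf k; exact: derivable_upto_affine. Qed.

(* The family [flat k] is closed under derivation up to linear combinations. *)
Definition flat (k : nat) (t : R) : R :=
  if 0 < t then t ^- k * expR (- t^-1) else 0.

Lemma flat_ge0 k t : 0 <= flat k t.
Proof.
by rewrite /flat; case: ifPn => // t0; rewrite mulr_ge0 ?expR_ge0// invr_ge0 exprn_ge0// ltW.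
Qed.

Lemma flat_gt0 k t : 0 < t -> 0 < flat k t.
Proof. by move=> t0; rewrite /flat t0 mulr_gt0 ?expR_gt0// invr_gt0 exprn_gt0. Qed.

Lemma flat_eq0 k t : t <= 0 -> flat k t = 0.
Proof. by rewrite /flat ltNge => ->. Qed.

(** The term of degree k + 2 of the exponential series at 1/t beats t^-k and leaves a factor t^2. A
    quadratic bound is what gives the derivative 0 at the origin, in [is_derive0_quadratic]. *)
Lemma flat_le k t : `|flat k t| <= k.+2`!%:R * `|t| ^+ 2.
Proof.
have [t0|t0] := ltP 0 t; last first.
  by rewrite flat_eq0// normr0 mulr_ge0// exprn_ge0.
rewrite ger0_norm ?flat_ge0// gtr0_norm// /flat t0 expRN.
have ti0 : 0 < t^-1 by rewrite invr_gt0.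
have := expR_ge1Dxn k.+1 (ltW ti0) => h.
have {}h : t^-1 ^+ k.+2 / k.+2`!%:R <= expR t^-1.
  by apply: le_trans h; rewrite lerDr.
have f0 : 0 < k.+2`!%:R :> R by rewrite ltr0n fact_gt0.
have p0 : 0 < t^-1 ^+ k.+2 / k.+2`!%:R by rewrite divr_gt0// exprn_gt0.
have : (expR t^-1)^-1 <= (t^-1 ^+ k.+2 / k.+2`!%:R)^-1.
  by rewrite lef_pV2// posrE ?expR_gt0.
rewrite invf_div exprVn invrK => h2.
apply: (@le_trans _ _ (t ^- k * (k.+2`!%:R * t ^+ k.+2))).
  by apply: ler_wpM2l => //; rewrite invr_ge0 exprn_ge0// ltW.
rewrite mulrCA ler_pM2l// -addn2 exprD mulKf// expf_neq0// gt_eqF//.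
Qed.

Lemma is_derive0_quadratic f (c : R) : (forall t, `|f t| <= c * `|t| ^+ 2) ->
  is_derive (0 : R) 1 f 0.
Proof.
move=> fc.
have f0 : f 0 = 0.
  by apply/eqP; rewrite -normr_le0; apply: le_trans (fc 0) _; rewrite normr0 expr0n mulr0.
have c0 : 0 <= c.
  by have := le_trans (normr_ge0 _) (fc 1); rewrite normr1 expr1n mulr1.
have lim0 : h^-1 *: ((f \o shift 0) (h *: (1 : R)) - f 0) @[h --> (0 : R)^'] --> (0 : R).
  apply/cvgrPdist_le => e e0.
  near=> h.
  have hn0 : h != 0 by near: h; exact: nbhs_dnbhs_neq.
  rewrite sub0r normrN /= f0 subr0 addr0 !scalerE mulr1 normrM normfV.
  rewrite ler_pdivrMl ?normr_gt0// (le_trans (fc _))//.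
  rewrite expr2 mulrA mulrC ler_wpM2l//.
  have : `|h| <= e / (c + 1).
    near: h; apply: nbhs_dnbhs; apply/nbhs_ballP.
    exists (e / (c + 1)) => /=; first by rewrite divr_gt0// ltr_wpDl.
    by move=> y; rewrite /ball /= sub0r normrN => /ltW.
  rewrite ler_pdivlMr; last by rewrite ltr_wpDl.
  by rewrite mulrDr mulr1 mulrC => h1; rewrite (le_trans _ h1)// lerDl.
apply: DeriveDef; first by apply/cvg_ex; exists 0.
exact: cvg_lim lim0.
Unshelve. all: by end_near. Qed.

Lemma is_derive_flat k t :
  is_derive (t : R) (1 : R) (flat k) (flat k.+2 t - k%:R * flat k.+1 t).
Proof.
have [t0|t0|->] := ltgtP t 0.
- rewrite !flat_eq0 ?ltW// mulr0 subr0.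
  have d0 : is_derive t (1 : R) (cst (0 : R)) 0 by exact: is_derive_cst.
  apply: near_eq_is_derive d0.
  by near=> a; rewrite /= flat_eq0// ltW//; near: a; exact: lt_nbhsl.
- have tn0 : t != 0 by rewrite gt_eqF.
  have dV : is_derive t (1 : R) (fun t => t^-1) (- t ^- 2).
    by apply: DeriveDef; [exact: derivableV|rewrite deriveV// derive_id scalerE mulr1].
  have dE : is_derive t (1:R) (expR \o (- (fun t => t^-1))) (expR (- t^-1) * t ^- 2).
    have dN := is_deriveN dV; rewrite opprK in dN.
    exact: (is_derive1_comp (is_derive_expR _) dN).
  have powE j x : ((fun t : R => t^-1) ^+ j) x = x ^- j :> R.
    by rewrite -exprVn; elim: j => //= j IH; rewrite !exprS -IH.
  have dP := @is_deriveX _ _ _ k _ _ _ dV.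
  have dM := @is_deriveM _ _ _ _ _ _ _ _ dP dE.
  have -> : flat k.+2 t - k%:R * flat k.+1 t =
      ((fun t : R => t^-1) ^+ k) t * (expR (- t^-1) * t ^- 2) +
      expR (- t^-1) * ((k%:R * t^-1 ^+ k.-1) * (- t ^- 2)).
    rewrite /flat t0 powE exprVn; case: k {dP dM} => [|k] /=.
      by rewrite !mul0r mulr0 subr0 addr0 expr0 invr1 mul1r mulrC.
    by rewrite !exprSr expr0; field; rewrite ?expf_neq0 ?tn0.
  apply: near_eq_is_derive dM.
  near=> a; rewrite /flat ifT; last by near: a; exact: lt_nbhsr.
  by rewrite -powE.
- rewrite !flat_eq0// mulr0 subr0.
  exact: is_derive0_quadratic (flat_le k).
Unshelve. all: by end_near. Qed.

Lemma smooth1_flat k : smooth1 (flat k).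
Proof.
move=> m; elim: m k => //= m IH k; split.
  by move=> t; have [] := is_derive_flat k t.
rewrite (_ : derive1 _ = flat k.+2 \+ (cst (- k%:R) \* flat k.+1)).
  apply: derivable_uptoD => //; apply: derivable_uptoM => //.
  exact: derivable_upto_cst.
apply/funext => t; rewrite derive1E; have /@derive_val -> := is_derive_flat k t.
by rewrite /= mulNr.
Qed.

Lemma derive1_flat0 t : derive1 (flat 0) t = flat 2 t.
Proof.
by rewrite derive1E; have /@derive_val -> := is_derive_flat 0 t; rewrite mul0r subr0.
Qed.

Definition up (t : R) : R := flat 0 (1 * t + (- 4^-1)).
Definition down (t : R) : R := flat 0 (- 1 * t + 3 / 4).

(** The supports of [up] and [down] overlap, so the denominator never vanishes. The transition takes
    place in [1/4, 3/4] rather than [0, 1]: after rescaling to a box this leaves a margin of a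
    quarter of the side, which puts the supports of the fields inside the open box. *)
Definition step : R -> R := up \* (fun t => ((up \+ down) t)^-1).

Lemma up_down_gt0 t : 0 < up t + down t.
Proof.
have [t4|t4] := ltP (4^-1) t.
  by rewrite ltr_wpDr ?flat_ge0// flat_gt0//; lra.
by rewrite ltr_wpDl ?flat_ge0// flat_gt0//; lra.
Qed.

Lemma smooth1_step : smooth1 step.
Proof.
have su : smooth1 up by apply: smooth1_affine; exact: smooth1_flat.
have sd : smooth1 down by apply: smooth1_affine; exact: smooth1_flat.
apply: smooth1M => //; apply: smooth1V; last exact: smooth1D.
by move=> t; rewrite gt_eqF// up_down_gt0.
Qed.

Lemma step_eq0 t : t <= 4^-1 -> step t = 0.
Proof. by move=> t4; rewrite /step /= /up flat_eq0 ?mul0r//; lra. Qed.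

Lemma step_eq1 t : 3 / 4 <= t -> step t = 1.
Proof.
move=> t4; have := up_down_gt0 t.
have d0 : down t = 0 by rewrite /down flat_eq0//; lra.
by rewrite /step /= d0 addr0 => u0; rewrite divff// gt_eqF.
Qed.

Lemma step_ge0 t : 0 <= step t.
Proof. by rewrite mulr_ge0 ?flat_ge0// invr_ge0 ltW// up_down_gt0. Qed.

Lemma step_le1 t : step t <= 1.
Proof. by rewrite ler_pdivrMr ?up_down_gt0// mul1r lerDl flat_ge0. Qed.

Definition bump : R -> R := derive1 step.

Lemma smooth1_bump : smooth1 bump.
Proof. exact/smooth1_derive1/smooth1_step. Qed.

(** In the quotient rule the terms up * up' cancel, and [down] decreases, so that what remains is a
    sum of nonnegative products; sign and zeros can then be read off. *)
Lemma bumpE t : bump t = (flat 2 (1 * t + (- 4^-1)) * down t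
  + up t * flat 2 (- 1 * t + 3 / 4)) / (up t + down t) ^+ 2.
Proof.
have du : is_derive t (1 : R) up (flat 2 (1 * t + (- 4^-1))).
  rewrite -[X in is_derive _ _ _ X]mul1r -derive1_flat0.
  by apply: is_derive_affine; apply: smooth1_derivable; exact: smooth1_flat.
have dd : is_derive t (1 : R) down (- flat 2 (- 1 * t + 3 / 4)).
  rewrite -[X in is_derive _ _ _ X]mulN1r -derive1_flat0.
  by apply: is_derive_affine; apply: smooth1_derivable; exact: smooth1_flat.
have n0 : up t + down t != 0 by rewrite gt_eqF// up_down_gt0.
rewrite /bump derive1E /step.
have dS : is_derive t (1 : R) (up \+ down) _ := is_deriveD du dd.
have dI := @is_derive_inv (up \+ down) _ _ n0 dS.
have dM : is_derive t (1 : R) (up \* (fun x => ((up \+ down) x)^-1)) _ :=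
  is_deriveM du dI.
have [_ ->] := dM.
rewrite !scalerE /=; field; exact: n0.
Qed.

Lemma bump_ge0 t : 0 <= bump t.
Proof.
by rewrite bumpE divr_ge0 ?exprn_ge0// ?addr_ge0// ?mulr_ge0 ?flat_ge0.
Qed.

Lemma bump_gt0 t : 4^-1 < t < 3 / 4 -> 0 < bump t.
Proof.
move=> /andP[t1 t3]; rewrite bumpE divr_gt0 ?exprn_gt0 ?up_down_gt0//.
by rewrite addr_gt0// mulr_gt0// flat_gt0//; lra.
Qed.

Lemma bump_eq0 t : t <= 4^-1 \/ 3 / 4 <= t -> bump t = 0.
Proof.
move=> h; rewrite bumpE; case: h => h.
  have -> : up t = 0 by rewrite /up flat_eq0//; lra.
  by rewrite flat_eq0 ?mul0r ?addr0 ?mul0r//; lra.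
have -> : down t = 0 by rewrite /down flat_eq0//; lra.
by rewrite mulr0 add0r [flat 2 _]flat_eq0 ?mulr0 ?mul0r//; lra.
Qed.

Lemma bump_bounded : exists2 c : R, 1 <= c & forall t, bump t <= c.
Proof.
have cb : {within `[0, 1 : R], continuous bump}.
  by apply: continuous_subspaceT; exact/smooth1_continuous/smooth1_bump.
have [c _ hc] := EVT_max (@ler01 R) cb.
exists (1 + `|bump c|); first by rewrite lerDl.
move=> t; have [/hc h|] := boolP (t \in `[0, 1 : R]).
  by rewrite (le_trans h)// (le_trans (ler_norm _))// lerDr.
rewrite in_itv /= negb_and -!ltNge => h.
rewrite bump_eq0 ?addr_ge0//.
by case/orP: h => h; [left|right]; lra.
Qed.

Lemma bump_lower : exists2 c : R, 0 < c &
  forall t, 3^-1 <= t <= 2 / 3 -> c <= bump t.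
Proof.
have cb : {within `[3^-1, 2 / 3 : R], continuous bump}.
  by apply: continuous_subspaceT; exact/smooth1_continuous/smooth1_bump.
have le : 3^-1 <= 2 / 3 :> R by lra.
have [c cI hc] := EVT_min le cb.
exists (bump c).
  by move: cI; rewrite in_itv/= => /andP[c1 c2]; apply: bump_gt0; lra.
by move=> t tI; apply: hc; rewrite in_itv.
Qed.

End smooth_line.

(** * Products of smooth functions and transport fields *)

Section smooth_space.
Context {R : realType} {n : nat}.
Implicit Types (f g : 'rV[R]_n -> R) (F G : 'I_n -> R -> R) (x : 'rV[R]_n).

Lemma is_derive_along_line f x (v : 'rV[R]_n) (c : R) (g : R -> R) (a : R) :
  derivable g a 1 -> (forall h, f (h *: v + x) = c * g (h + a)) ->
  is_derive x v f (c * derive1 g a).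
Proof.
move=> dg fg.
have f0 : f x = c * g a by rewrite -[x]add0r -(scale0r v) fg add0r.
have lim : h^-1 *: ((f \o shift x) (h *: v) - f x) @[h --> (0 : R)^'] -->
    c * derive1 g a.
  have -> : (fun h => h^-1 *: ((f \o shift x) (h *: v) - f x)) =
      (fun h : R => c * (h^-1 *: ((g \o shift a) (h *: (1 : R)) - g a))).
    apply/funext => h; rewrite /= fg f0 -mulrBr.
    rewrite [LHS](_ : _ = h^-1 * (c * (g (h + a) - g a)))//.
    rewrite [in RHS](_ : h *: (1 : R) = h); last by rewrite [LHS]mulr1.
    by rewrite mulrCA.
  by apply: cvgMr; rewrite derive1E; exact: dg.
apply: DeriveDef; first by apply/cvg_ex; exists (c * derive1 g a).
exact: cvg_lim lim.
Qed.

Definition prodf F : 'rV[R]_n -> R := fun x => \prod_(i < n) F i (x ord0 i).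

Lemma prodfD1 F j x :
  prodf F x = (\prod_(i < n | i != j) F i (x ord0 i)) * F j (x ord0 j).
Proof. by rewrite /prodf (bigD1 j)//= mulrC. Qed.

Lemma is_derive_prodf F (j : 'I_n) x : (forall i t, derivable (F i) t 1) ->
  is_derive x (delta_mx ord0 j : 'rV[R]_n) (prodf F)
    (prodf (fun i => if i == j then derive1 (F i) else F i) x).
Proof.
move=> dF; rewrite [X in is_derive _ _ _ X](prodfD1 _ j) eqxx.
rewrite (eq_bigr (fun i => F i (x ord0 i))); last by move=> i /negbTE ->.
apply: is_derive_along_line => // h.
rewrite (prodfD1 _ j); congr (_ * _); last by rewrite !mxE !eqxx mulr1.
apply: eq_bigr => i ij; rewrite !mxE.
by rewrite (negbTE ij) andbF mulr0 add0r.
Qed.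

Lemma partial_prodf F (j : 'I_n) : (forall i, smooth1 (F i)) ->
  partial j (prodf F) =
  prodf (fun i => if i == j then derive1 (F i) else F i).
Proof.
move=> sF; apply/funext => x; rewrite /partial.
have dF i t : derivable (F i) t 1 by exact: smooth1_derivable.
by have [_ ->] := is_derive_prodf j x dF.
Qed.

Lemma derivable_prodf F (j : 'I_n) x : (forall i, smooth1 (F i)) ->
  derivable (prodf F) x (delta_mx ord0 j).
Proof.
move=> sF; have dF i t : derivable (F i) t 1 by exact: smooth1_derivable.
by have [] := is_derive_prodf j x dF.
Qed.

Lemma continuous_prodf F : (forall i, continuous (F i)) -> continuous (prodf F).
Proof.
move=> cF; rewrite /prodf; elim: (index_enum _) => [|i s IH].
  under eq_fun do rewrite big_nil; exact: cst_continuous.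
under eq_fun do rewrite big_cons.
move=> x; apply: (@continuousM _ _ (fun x => F i (x ord0 i))); last exact: IH.
apply: (@continuous_comp _ _ _ (fun x : 'rV[R]_n => x ord0 i) (F i)).
  exact: coord_continuous.
exact: cF.
Qed.

(** Products of smooth functions of separate variables are stable under [partial]; this reduces
    [smooth] to [smooth1] for all the fields built below. *)
Lemma iter_partial_prodf F s : (forall i, smooth1 (F i)) ->
  exists2 G, (forall i, smooth1 (G i)) & iter_partial s (prodf F) = prodf G.
Proof.
move=> sF; elim: s => [|j s [G sG GE]]; first by exists F.
exists (fun i => if i == j then derive1 (G i) else G i).
  by move=> i; case: ifP => // _; exact: smooth1_derive1.
by rewrite /= GE partial_prodf.
Qed.

Lemma smooth_prodf F : (forall i, smooth1 (F i)) -> smooth (prodf F).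
Proof.
move=> sF s; have [G sG ->] := iter_partial_prodf s sF; split.
  by apply: continuous_prodf => i; exact: smooth1_continuous.
by move=> i x; exact: derivable_prodf.
Qed.

Lemma smooth_derivable f x i : smooth f -> derivable f x (delta_mx ord0 i).
Proof. by move=> /(_ [::])[_]; exact. Qed.

Lemma smooth_continuous f : smooth f -> continuous f.
Proof. by move=> /(_ [::])[]. Qed.

Lemma partialD f g i : smooth f -> smooth g ->
  partial i (f \+ g) = partial i f \+ partial i g.
Proof.
by move=> sf sg; apply/funext => x /=; apply: deriveD; exact: smooth_derivable.
Qed.

(** [iter_partial] takes the last index of the list first, so an additional inner derivative is an
    [rcons]; this is also why the inductions below run from the end of the list. *)
Lemma smooth_partial f i : smooth f -> smooth (partial i f).
Proof.
move=> sf s; have := sf (rcons s i).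
by rewrite /iter_partial foldr_rcons.
Qed.

Lemma iter_partialD s f g : smooth f -> smooth g ->
  iter_partial s (f \+ g) = iter_partial s f \+ iter_partial s g.
Proof.
elim/last_ind: s f g => // s i IH f g sf sg.
rewrite /iter_partial !foldr_rcons -!/(iter_partial s _) (partialD i sf sg).
by rewrite IH; [|exact: smooth_partial|exact: smooth_partial].
Qed.

Lemma smoothD f g : smooth f -> smooth g -> smooth (f \+ g).
Proof.
move=> sf sg s; rewrite iter_partialD//.
have [cf df] := sf s; have [cg dg] := sg s; split.
  by move=> x; exact: (continuousD (cf x) (cg x)).
by move=> i x; exact: (derivableD (df i x) (dg i x)).
Qed.

Lemma partialM_cst (c : R) f i : smooth f ->
  partial i (fun x => c * f x) = (fun x => c * partial i f x).
Proof.
by move=> sf; apply/funext => x; apply: deriveZ; exact: smooth_derivable.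
Qed.

Lemma iter_partialM_cst (c : R) s f : smooth f ->
  iter_partial s (fun x => c * f x) = (fun x => c * iter_partial s f x).
Proof.
elim/last_ind: s f => // s i IH f sf.
rewrite /iter_partial !foldr_rcons -!/(iter_partial s _) (partialM_cst c i sf).
by rewrite IH//; exact: smooth_partial.
Qed.

Lemma smoothM_cst (c : R) f : smooth f -> smooth (fun x => c * f x).
Proof.
move=> sf s; rewrite iter_partialM_cst//.
have [cf df] := sf s; split.
  by move=> x; apply: (@continuousM _ _ (cst c)); [exact: cst_continuous|exact: cf].
by move=> i x; apply: derivableZ; exact: df.
Qed.

Lemma smooth_cst (c : R) : smooth (fun _ : 'rV[R]_n => c).
Proof.
move=> s.
have [d ->] : exists d : R, iter_partial s (fun _ : 'rV[R]_n => c) = fun=> d.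
  elim: s => [|i s [d IH]]; first by exists c.
  by exists 0; rewrite /= IH; apply/funext => x; exact: derive_cst.
split=> [|i x]; [exact: cst_continuous|exact: derivable_cst].
Qed.

Lemma smooth_sum (I : Type) (s : seq I) (f : I -> 'rV[R]_n -> R) :
  (forall i, smooth (f i)) -> smooth (fun x => \sum_(i <- s) f i x).
Proof.
move=> sf; elim: s => [|i s IH].
  by under eq_fun do rewrite big_nil; exact: smooth_cst.
by under eq_fun do rewrite big_cons; exact: (smoothD (sf i) IH).
Qed.

Lemma partial_sum (I : Type) (s : seq I) (f : I -> 'rV[R]_n -> R) j :
  (forall i, smooth (f i)) ->
  partial j (fun x => \sum_(i <- s) f i x) =
  (fun x => \sum_(i <- s) partial j (f i) x).
Proof.
move=> sf; elim: s => [|i s IH].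
  under eq_fun do rewrite big_nil.
  by apply/funext => x; rewrite big_nil; exact: derive_cst.
under eq_fun do rewrite big_cons.
under [RHS]eq_fun do rewrite big_cons.
have sS : smooth (fun x => \sum_(k <- s) f k x) by exact: smooth_sum.
rewrite (_ : (fun x => f i x + _) = f i \+ (fun x => \sum_(k <- s) f k x))//.
by rewrite (partialD j (sf i) sS) IH.
Qed.

End smooth_space.

Section boxes.
Context {R : realType} {n : nat}.
Implicit Types (o : 'rV[R]_n) (l L : R) (x : 'rV[R]_n).

Definition obox o L : set 'rV[R]_n :=
  [set x | forall i, o ord0 i < x ord0 i < o ord0 i + L].

(** Half-open, so that the 2^n halves of a box partition it and volumes add up exactly. The open
    boxes [obox] carry the test fields and the total variations. *)
Definition hbox o L : set 'rV[R]_n :=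
  [set x | forall i, o ord0 i <= x ord0 i < o ord0 i + L].

(** [sbump] is the derivative of [sstep], which climbs from 0 to 1 across an interval of length [l].
    Hence [bbox] is a smooth probability density on the box, and pairing a function with it gives a
    smoothed mean. *)
Definition sstep (a l t : R) : R := step (l^-1 * t + (- (a / l))).
Definition sbump (a l t : R) : R := l^-1 * bump (l^-1 * t + (- (a / l))).

Lemma smooth1_sstep a l : smooth1 (sstep a l).
Proof. by apply: smooth1_affine; exact: smooth1_step. Qed.

Lemma derive1_sstep a l : derive1 (sstep a l) = sbump a l.
Proof.
apply/funext => t; rewrite derive1E.
have := @is_derive_affine R step l^-1 (- (a / l)) t
  (@smooth1_derivable R step _ smooth1_step).
by move=> /@derive_val ->.
Qed.

Lemma smooth1_sbump a l : smooth1 (sbump a l).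
Proof. by rewrite -derive1_sstep; apply: smooth1_derive1; exact: smooth1_sstep. Qed.

Lemma sstep_ge0 a l t : 0 <= sstep a l t. Proof. exact: step_ge0. Qed.

Lemma sstep_le1 a l t : sstep a l t <= 1. Proof. exact: step_le1. Qed.

Let scaled (a l t : R) : l^-1 * t + (- (a / l)) = (t - a) / l.
Proof. by rewrite mulrBl mulrC. Qed.

Lemma sstep_eq0 a l t : 0 < l -> t <= a + l / 4 -> sstep a l t = 0.
Proof.
move=> l0 tl; rewrite /sstep scaled step_eq0// ler_pdivrMr//; lra.
Qed.

Lemma sstep_eq1 a l t : 0 < l -> a + 3 / 4 * l <= t -> sstep a l t = 1.
Proof.
by move=> l0 tl; rewrite /sstep scaled step_eq1// ler_pdivlMr//; lra.
Qed.

Lemma sbump_ge0 a l t : 0 < l -> 0 <= sbump a l t.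
Proof. by move=> l0; rewrite mulr_ge0 ?bump_ge0// invr_ge0 ltW. Qed.

Lemma sbump_eq0 a l t : 0 < l -> t <= a + l / 4 \/ a + 3 / 4 * l <= t ->
  sbump a l t = 0.
Proof.
move=> l0 tl; rewrite /sbump scaled bump_eq0 ?mulr0//.
by case: tl => tl; [left; rewrite ler_pdivrMr//; lra
                   |right; rewrite ler_pdivlMr//; lra].
Qed.

Definition bbox o l : 'rV[R]_n -> R := prodf (fun i => sbump (o ord0 i) l).

Lemma bbox_ge0 o l x : 0 < l -> 0 <= bbox o l x.
Proof. by move=> l0; apply: prodr_ge0 => i _; exact: sbump_ge0. Qed.

Lemma continuous_bbox o l : continuous (bbox o l).
Proof.
by apply: continuous_prodf => i; exact/smooth1_continuous/smooth1_sbump.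
Qed.

Lemma bbox_eq0 o l x : 0 < l -> ~ obox o l x -> bbox o l x = 0.
Proof.
move=> l0 /existsNP[i /negP]; rewrite negb_and -!leNgt => oi.
rewrite /bbox /prodf (bigD1 i)//= sbump_eq0 ?mul0r//.
by case/orP: oi => oi; [left|right]; lra.
Qed.

(* The field carrying the density of the box [o', l] to that of the box
   [o, L], one coordinate after the other. *)
Definition transport_factor o L o' l (i k : 'I_n) : R -> R :=
  if (k < i)%N then sbump (o ord0 k) L
  else if k == i then (fun t => sstep (o' ord0 k) l t - sstep (o ord0 k) L t)
  else sbump (o' ord0 k) l.

Definition transport o L o' l (x : 'rV[R]_n) : 'rV[R]_n :=
  \row_i prodf (transport_factor o L o' l i) x.

Lemma smooth1B (f g : R -> R) : smooth1 f -> smooth1 g ->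
  smooth1 (fun t => f t - g t).
Proof.
move=> sf sg.
rewrite (_ : (fun t => _) = f \+ (cst (- 1) \* g)); last first.
  by apply/funext => t /=; rewrite mulN1r.
by apply: smooth1D => //; apply: smooth1M => //; exact: smooth1_cst.
Qed.

Lemma smooth1_transport_factor o L o' l i k :
  smooth1 (transport_factor o L o' l i k).
Proof.
rewrite /transport_factor; case: ifP => _; first exact: smooth1_sbump.
case: ifP => _; last exact: smooth1_sbump.
by apply: smooth1B; exact: smooth1_sstep.
Qed.

Lemma smooth_transport o L o' l i :
  smooth (fun x => transport o L o' l x ord0 i).
Proof.
under eq_fun do rewrite mxE.
by apply: smooth_prodf => k; exact: smooth1_transport_factor.
Qed.

Lemma divergence_transport o L o' l x :
  divergence (transport o L o' l) x = bbox o' l x - bbox o L x.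
Proof.
(* [T m] has its first m coordinates already moved to the box [o, L] and the others still in
   [o', l]. The i-th partial derivative of the i-th component is [T i - T i.+1], and the sum
   telescopes. *)
pose T (m : nat) := \prod_(k < n)
  (if (k < m)%N then sbump (o ord0 k) L (x ord0 k)
   else sbump (o' ord0 k) l (x ord0 k)).
have -> : bbox o' l x = T 0 by [].
have -> : bbox o L x = T n.
  by apply: eq_bigr => k _; rewrite ltn_ord.
rewrite /divergence (eq_bigr (fun i : 'I_n => T i - T i.+1)); last first.
  move=> i _; under eq_fun do rewrite mxE.
  rewrite partial_prodf; last by move=> k; exact: smooth1_transport_factor.
  pose P := \prod_(k < n | k != i) transport_factor o L o' l i k (x ord0 k).
  have -> : T i = P * sbump (o' ord0 i) l (x ord0 i).
    rewrite /T (bigD1 i)//= ltnn mulrC; congr (_ * _).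
    apply: eq_bigr => k ki; rewrite /transport_factor (negbTE ki).
    by case: ifP.
  have -> : T i.+1 = P * sbump (o ord0 i) L (x ord0 i).
    rewrite /T (bigD1 i)//= ltnSn mulrC; congr (_ * _).
    apply: eq_bigr => k ki; rewrite /transport_factor (negbTE ki).
    by rewrite ltnS leq_eqVlt (negbTE (ki : nat_of_ord k != i)) /=; case: ifP.
  rewrite (prodfD1 _ i) eqxx.
  rewrite -mulrBr; congr (_ * _).
    by apply: eq_bigr => k /negbTE ->.
  rewrite /transport_factor ltnn eqxx derive1E.
  rewrite deriveB; [|exact/smooth1_derivable/smooth1_sstep..].
  by rewrite -!derive1E !derive1_sstep.
rewrite -(big_mkord xpredT (fun i => T i - T i.+1)).
under eq_bigr do rewrite -opprB.
by rewrite sumrN telescope_sumr// opprB.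
Qed.

(** One factor is a difference of two steps, of absolute value at most 1; only the other n - 1
    factors are densities of size c / l. The missing factor makes a jump cost the side of the cube
    times the density. *)
Lemma transport_le o L o' l (c : R) x i : 0 < l -> l <= L ->
  (forall t, bump t <= c) -> 
  `|transport o L o' l x ord0 i| <= (c / l) ^+ n.-1.
Proof.
move=> l0 lL bc; have L0 : 0 < L := lt_le_trans l0 lL.
have c0 : 0 <= c := le_trans (bump_ge0 0) (bc 0).
rewrite mxE (prodfD1 _ i) normrM -[leRHS]mulr1 ler_pM//.
  rewrite normr_prod.
  have -> : (c / l) ^+ n.-1 = \prod_(k < n | k != i) (c / l).
    by rewrite prodr_const cardC1 card_ord.
  apply: ler_prod => k ki; rewrite normr_ge0 /=.
  have bl a t : `|sbump a l t| <= c / l.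
    by rewrite ger0_norm ?sbump_ge0// /sbump mulrC ler_wpM2r// invr_ge0 ltW.
  have bL a t : `|sbump a L t| <= c / l.
    rewrite ger0_norm ?sbump_ge0// /sbump mulrC.
    apply: ler_pM => //; rewrite ?bump_ge0// ?invr_ge0 ?(ltW L0)//.
    by rewrite lef_pV2.
  by rewrite /transport_factor (negbTE ki); case: ifP.
rewrite /transport_factor ltnn eqxx.
have := sstep_ge0 (o' ord0 i) l (x ord0 i).
have := sstep_le1 (o' ord0 i) l (x ord0 i).
have := sstep_ge0 (o ord0 i) L (x ord0 i).
have := sstep_le1 (o ord0 i) L (x ord0 i).
by rewrite ler_norml => *; apply/andP; split; lra.
Qed.

Definition cbox o (a b : R) : set 'rV[R]_n :=
  [set x | forall i, o ord0 i + a <= x ord0 i <= o ord0 i + b].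

Lemma compact_cbox o a b : compact (cbox o a b).
Proof.
have := @rV_compact R n (fun i => `[o ord0 i + a, o ord0 i + b]%classic).
have -> : [set v : 'rV[R]_n | forall i, `[o ord0 i + a, o ord0 i + b]%classic (v ord0 i)]
   = cbox o a b.
  by apply/seteqP; split => x h i; have := h i; rewrite /= in_itv.
by apply => i; exact: segment_compact.
Qed.

(** Let the coordinate k be less than l/4 away from a face of the large box, or beyond it. Both
    bumps in this coordinate vanish, and the two steps are both 0 or both 1, so every component has
    a zero factor. *)
Lemma transport_support o L o' l x : 0 < l -> l <= L ->
  (forall i, o ord0 i <= o' ord0 i /\ o' ord0 i + l <= o ord0 i + L) ->
  transport o L o' l x != 0 -> cbox o (l / 4) (L - l / 4) x.
Proof.
move=> l0 lL sub; have L0 : 0 < L := lt_le_trans l0 lL.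
apply: contra_neqP => /existsNP[k kx].
apply/rowP => i; rewrite !mxE /prodf (bigD1 k)//=.
rewrite (_ : transport_factor _ _ _ _ _ _ _ = 0) ?mul0r//.
have [s1 s2] := sub k.
move/negP: kx; rewrite negb_and -!ltNge => kx.
have bl : sbump (o' ord0 k) l (x ord0 k) = 0.
  by apply: sbump_eq0 => //; case/orP: kx => kx; [left|right]; lra.
have bL : sbump (o ord0 k) L (x ord0 k) = 0.
  by apply: sbump_eq0 => //; case/orP: kx => kx; [left|right]; lra.
rewrite /transport_factor; case: ifP => // _; case: ifP => // _.
case/orP: kx => kx; first by rewrite !sstep_eq0 ?subrr//; lra.
by rewrite !sstep_eq1 ?subrr//; lra.
Qed.

End boxes.

(** * Total variation *)

Section measurability.
Context {R : realType} {n : nat}.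
Implicit Types (U : set 'rV[R]_n) (g : 'rV[R]_n -> R).

Lemma open_measurable_rV U : open U -> measurable U.
Proof. by move=> oU; rewrite measurable_rVE; exact: sub_sigma_algebra. Qed.

Lemma continuous_measurable_rV g : continuous g -> measurable_fun setT g.
Proof.
move=> cg; apply: (measurability _ (RGenOpens.measurableE R)) => //.
move=> _ [_ [a [b ->]] <-]; rewrite setTI.
apply: open_measurable_rV.
by apply: open_comp => // x _; exact: cg.
Qed.

End measurability.

Section variation.
Context {R : realType} {n : nat}.
Let mu := @lebesgue_rV R n.
Implicit Types (U V W K : set 'rV[R]_n) (v : 'rV[R]_n -> 'rV[R]_n).

Lemma enorm_ge0 (x : 'rV[R]_n) : 0 <= enorm x. Proof. exact: sqrtr_ge0. Qed.

Lemma enorm0 : enorm (0 : 'rV[R]_n) = 0.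
Proof.
by rewrite /enorm big1 ?sqrtr0// => i _; rewrite mxE expr0n.
Qed.

Lemma enormZ (c : R) (x : 'rV[R]_n) : enorm (c *: x) = `|c| * enorm x.
Proof.
rewrite /enorm -sqrtr_sqr -sqrtrM ?sqr_ge0// mulr_sumr.
by congr Num.sqrt; apply: eq_bigr => i _; rewrite mxE exprMn.
Qed.

Lemma enorm_le_sum (x : 'rV[R]_n) : enorm x <= \sum_(i < n) `|x ord0 i|.
Proof.
suff [h s0] : \sum_(i < n) x ord0 i ^+ 2 <= (\sum_(i < n) `|x ord0 i|) ^+ 2 /\
    0 <= \sum_(i < n) `|x ord0 i|.
  by rewrite -(ger0_norm s0) -sqrtr_sqr ler_wsqrtr.
elim/big_rec2 : _ => [|i a b _ [ba a0]]; first by rewrite expr0n.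
split; last exact: addr_ge0.
rewrite sqrrD real_normK ?num_real// -addrA lerD2l (le_trans ba)// lerDr.
by rewrite mulrn_wge0// mulr_ge0.
Qed.

Lemma ler_enorm (x : 'rV[R]_n) i : `|x ord0 i| <= enorm x.
Proof.
rewrite -sqrtr_sqr ler_wsqrtr// (bigD1 i)//= lerDl.
by apply: sumr_ge0 => j _; exact: sqr_ge0.
Qed.

Lemma test_fieldP U K v : (forall i, smooth (fun x => v x ord0 i)) ->
  compact K -> K `<=` U -> (forall x, v x != 0 -> K x) -> test_field U v.
Proof.
move=> sv cK KU vK.
have clK : closed K by apply: compact_closed => //; exact: norm_hausdorff.
have sub : closure [set x | v x != 0] `<=` K.
  by rewrite [X in _ `<=` X](iffLR (closure_id _) clK); exact: closure_subset.
split=> //; last exact: subset_trans KU.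
by apply: subclosed_compact cK sub; exact: closed_closure.
Qed.

Lemma test_field_sub U V v : U `<=` V -> test_field U v -> test_field V v.
Proof. by move=> UV [sv cv vU]; split=> //; exact: subset_trans UV. Qed.

Lemma test_field_eq0 U v x : test_field U v -> ~ U x -> v x = 0.
Proof.
move=> [_ _ vU] Ux; apply/eqP/negP => /negP vx; apply: Ux; apply: vU.
exact: subset_closure.
Qed.

Lemma partial_eq0 U v x i : test_field U v -> ~ U x ->
  partial i (fun y => v y ord0 i) x = 0.
Proof.
move=> [_ _ vU] Ux; rewrite /partial.
rewrite (@near_eq_derive _ _ _ _ (fun=> 0)) ?derive_cst//.
have : nbhs x (~` closure [set x | v x != 0]).
  apply: open_nbhs_nbhs; split; last by move=> /vU.
  exact/closed_openC/closed_closure.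
apply: filterS => y /= vy.
have -> : v y = 0 by apply/eqP/negP => /negP ?; apply: vy; exact: subset_closure.
by rewrite mxE.
Qed.

Lemma divergence_eq0 U v x : test_field U v -> ~ U x -> divergence v x = 0.
Proof.
by move=> tv Ux; rewrite /divergence big1// => i _; exact: partial_eq0 tv Ux.
Qed.

Lemma continuous_partial U v i : test_field U v ->
  continuous (partial i (fun y => v y ord0 i)).
Proof. by move=> [sv _ _]; apply: smooth_continuous; exact: smooth_partial. Qed.

Lemma continuous_sum (I : Type) (s : seq I) (f : I -> 'rV[R]_n -> R) :
  (forall i, continuous (f i)) -> continuous (fun x => \sum_(i <- s) f i x).
Proof.
move=> cf; elim: s => [|i s IH].
  by under eq_fun do rewrite big_nil; exact: cst_continuous.
under eq_fun do rewrite big_cons.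
by move=> x; exact: (continuousD (cf i x) (IH x)).
Qed.

Lemma continuous_divergence U v : test_field U v -> continuous (divergence v).
Proof. by move=> tv; apply: continuous_sum => i; exact: continuous_partial tv. Qed.

Lemma compact_support_bounded (f : 'rV[R]_n -> R) K : compact K ->
  continuous f -> (forall x, ~ K x -> f x = 0) ->
  exists2 c : R, 0 <= c & forall x, `|f x| <= c.
Proof.
move=> cK cf f0; have [K0|/set0P[k Kk]] := eqVneq K set0.
  by exists 0 => // x; rewrite f0 ?normr0// K0.
have cn : {within K, continuous (fun x => `|f x|)}.
  apply: continuous_subspaceT => x.
  by apply: (@continuous_comp _ _ _ f Num.norm); [exact: cf|exact: norm_continuous].
have [|c cK' hc] := compact_EVT_max _ cK cn; first by exists k.
exists `|f c| => // x; have [Kx|Kx] := pselect (K x).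
  by apply: hc; rewrite inE.
by rewrite f0// normr0.
Qed.

Lemma test_field_bounded U v : test_field U v ->
  exists2 c : R, 0 <= c & forall x, `|divergence v x| <= c.
Proof.
move=> tv; have [sv cv vU] := tv.
apply: (compact_support_bounded cv (continuous_divergence tv)) => x.
by apply: (@divergence_eq0 (closure [set x | v x != 0])); split.
Qed.

Lemma test_fieldZ U (c : R) v : test_field U v ->
  test_field U (fun x => c *: v x).
Proof.
move=> [sv cv vU]; apply: (test_fieldP _ cv vU) => [i|x cvx].
  by under eq_fun do rewrite mxE; exact: smoothM_cst.
by apply: subset_closure; apply: contra_neq cvx => ->; rewrite scaler0.
Qed.

Lemma divergenceZ U (c : R) v x : test_field U v ->
  divergence (fun x => c *: v x) x = c * divergence v x.
Proof.
move=> [sv cv vU]; rewrite /divergence mulr_sumr; apply: eq_bigr => i _.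
by under eq_fun do rewrite mxE; rewrite partialM_cst.
Qed.

Lemma test_field0 U : test_field U (fun=> 0).
Proof.
apply: (@test_fieldP _ set0) => //; first last.
- by move=> x; rewrite eqxx.
- exact: compact0.
by move=> i; under eq_fun do rewrite mxE; exact: smooth_cst.
Qed.

Lemma test_field_sum (I : finType) (U : I -> set 'rV[R]_n)
    (v : I -> 'rV[R]_n -> 'rV[R]_n) W :
  (forall i, test_field (U i) (v i)) -> (forall i, U i `<=` W) ->
  test_field W (fun x => \sum_i v i x).
Proof.
move=> tv UW; pose K := \bigcup_(i in [set` index_enum I]) closure [set x | v i x != 0].
apply: (@test_fieldP _ K).
- move=> j; under eq_fun do rewrite summxE.
  by apply: smooth_sum => i; have [] := tv i.
- rewrite /K bigcup_seq; elim/big_ind : _ => [|A B|i _].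
  + exact: compact0.
  + exact: compactU.
  + by have [] := tv i.
- by move=> x [i _]; have [_ _ h] := tv i => /h; exact: UW.
- move=> x vx; apply: contrapT => Kx; move/eqP: vx; apply.
  rewrite big1// => i _; apply/eqP/negP => /negP vix; apply: Kx.
  by exists i; [rewrite /= mem_index_enum|exact: subset_closure].
Qed.

Lemma divergence_sum (I : finType) (v : I -> 'rV[R]_n -> 'rV[R]_n) x :
  (forall i j, smooth (fun x => v i x ord0 j)) ->
  divergence (fun x => \sum_i v i x) x = \sum_i divergence (v i) x.
Proof.
move=> sv; rewrite /divergence exchange_big/=; apply: eq_bigr => j _.
by under eq_fun do rewrite summxE; rewrite partial_sum.
Qed.

Variable w : 'rV[R]_n -> R.
Hypothesis iw : mu.-integrable setT (EFin \o w).

Lemma integrable_mul_bounded (g : 'rV[R]_n -> R) (c : R) :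
  measurable_fun setT g -> (forall x, `|g x| <= c) ->
  mu.-integrable setT (EFin \o (fun x => w x * g x)).
Proof.
move=> mg gc.
have := @integrableMl _ _ _ mu setT measurableT (EFin \o w) g iw mg.
apply; exists c; split; first exact: num_real.
by move=> M cM x _; exact: le_trans (gc x) (ltW cM).
Qed.

Lemma integrable_divergence U v : test_field U v ->
  mu.-integrable setT (EFin \o (fun x => w x * divergence v x)).
Proof.
move=> tv; have [c _ hc] := test_field_bounded tv.
apply: (integrable_mul_bounded _ hc).
by apply: continuous_measurable_rV; exact: (continuous_divergence tv).
Qed.

Definition pairing (g : 'rV[R]_n -> R) : R := (\int[mu]_x (w x * g x))%R.

Definition pairable (g : 'rV[R]_n -> R) : Prop :=
  mu.-integrable setT (EFin \o (fun x => w x * g x)).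

Lemma pairableD g h : pairable g -> pairable h -> pairable (g \+ h).
Proof.
move=> ig ih; have := @integrableD _ _ _ mu setT measurableT _ _ ig ih.
by congr (is_true (integrable _ _ _)); apply/funext => x /=; rewrite mulrDr.
Qed.

Lemma pairableZ (c : R) g : pairable g -> pairable (fun x => c * g x).
Proof.
move=> ig; have := @integrableZl _ _ _ mu setT measurableT c _ ig.
by congr (is_true (integrable _ _ _)); apply/funext => x /=; rewrite mulrCA.
Qed.

Lemma pairingD g h : pairable g -> pairable h ->
  pairing (g \+ h) = pairing g + pairing h.
Proof.
move=> ig ih; rewrite /pairing -RintegralD//.
by apply: eq_Rintegral => x _; rewrite mulrDr.
Qed.

Lemma pairingZ (c : R) g : pairable g ->
  pairing (fun x => c * g x) = c * pairing g.
Proof.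
move=> ig; rewrite /pairing -RintegralZl//.
by apply: eq_Rintegral => x _; rewrite mulrCA.
Qed.

Lemma pairable0 : pairable (fun=> 0).
Proof.
have := @integrable0 _ _ _ mu setT.
by congr (is_true (integrable _ _ _)); apply/funext => x /=; rewrite mulr0.
Qed.

Lemma pairable_sum (I : Type) (s : seq I) (g : I -> 'rV[R]_n -> R) :
  (forall i, pairable (g i)) -> pairable (fun x => \sum_(i <- s) g i x).
Proof.
move=> ig; elim: s => [|i s IH].
  by under eq_fun do rewrite big_nil; exact: pairable0.
by under eq_fun do rewrite big_cons; exact: (pairableD (ig i) IH).
Qed.

Lemma pairing_sum (I : Type) (s : seq I) (g : I -> 'rV[R]_n -> R) :
  (forall i, pairable (g i)) ->
  pairing (fun x => \sum_(i <- s) g i x) = \sum_(i <- s) pairing (g i).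
Proof.
move=> ig; elim: s => [|i s IH].
  rewrite big_nil /pairing; under eq_Rintegral do rewrite big_nil mulr0.
  by rewrite /Rintegral integral0.
rewrite big_cons -IH -pairingD//; last exact: pairable_sum.
by congr pairing; apply/funext => x; rewrite big_cons.
Qed.

Lemma pairing_test U v : test_field U v ->
  (\int[mu]_(x in U) (w x * divergence v x)%:E)%E = (pairing (divergence v))%:E.
Proof.
move=> tv; rewrite integral_mkcond.
have -> : (fun x => (w x * divergence v x)%:E) \_ U =
    EFin \o (fun x => w x * divergence v x).
  apply/funext => x; rewrite patchE; case: ifPn => // /negP.
  by rewrite inE => Ux /=; rewrite (divergence_eq0 tv Ux) mulr0.
rewrite /pairing /Rintegral fineK//.
exact: integrable_fin_num (integrable_divergence tv).
Qed.

Lemma total_variation_ge0 U : (0 <= total_variation w U)%E.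
Proof.
apply: ereal_sup_ubound; exists (fun=> 0).
  by split=> [|x]; [exact: test_field0|rewrite enorm0].
rewrite integral0_eq// => x _.
rewrite [divergence _ _]big1 ?mulr0// => i _.
by rewrite /partial; under eq_fun do rewrite mxE; exact: derive_cst.
Qed.

Lemma total_variation_mono U V : U `<=` V ->
  (total_variation w U <= total_variation w V)%E.
Proof.
move=> UV; apply: ge_ereal_sup => _ [v [tv v1] <-].
rewrite (pairing_test tv); have tV := test_field_sub UV tv.
by rewrite -(pairing_test tV); apply: ereal_sup_ubound; exists v.
Qed.

Hypothesis fw : (total_variation w setT < +oo)%E.

Lemma total_variation_fin U : total_variation w U \is a fin_num.
Proof.
rewrite ge0_fin_numE ?total_variation_ge0//.
exact: le_lt_trans (total_variation_mono (@subsetT _ U)) fw.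
Qed.

(* 0 when the total variation is infinite. *)
Definition tvr U : R := fine (total_variation w U).

Lemma tvr_ge0 U : 0 <= tvr U.
Proof. by apply: fine_ge0; exact: total_variation_ge0. Qed.

Lemma tvr_mono U V : U `<=` V -> tvr U <= tvr V.
Proof.
by move=> UV; rewrite fine_le ?total_variation_fin//; exact: total_variation_mono.
Qed.

Lemma pairing_le_tvr U v (k : R) : 0 < k -> test_field U v ->
  (forall x, enorm (v x) <= k) -> pairing (divergence v) <= k * tvr U.
Proof.
move=> k0 tv vk.
have tV := test_fieldZ k^-1 tv.
have h : pairing (divergence (fun x => k^-1 *: v x)) <= tvr U.
  rewrite -lee_fin -(pairing_test tV) /tvr fineK ?total_variation_fin//.
  apply: ereal_sup_ubound; exists (fun x => k^-1 *: v x) => //; split=> // x.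
  by rewrite enormZ gtr0_norm ?invr_gt0// ler_pdivrMl// mulr1.
rewrite mulrC -ler_pdivrMr// mulrC.
apply: le_trans h; rewrite -pairingZ; last exact: integrable_divergence tv.
rewrite [leLHS](_ : _ = pairing (divergence (fun x => k^-1 *: v x)))//.
by congr pairing; apply/funext => x; rewrite (divergenceZ _ _ tv).
Qed.

Lemma tvr_attained U (e : R) : 0 < e -> exists2 v, test_field U v /\
  (forall x, enorm (v x) <= 1) & tvr U - e < pairing (divergence v).
Proof.
move=> e0.
have [_ [v [tv v1] <-]] := ub_ereal_sup_adherent e0 (total_variation_fin U).
rewrite (pairing_test tv) -/(total_variation w U).
rewrite -[X in (X - _)%E](fineK (total_variation_fin U)) -EFinB lte_fin => h.
by exists v.
Qed.

Lemma tvr_superadditive (I : finType) (U : I -> set 'rV[R]_n) W :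
  (forall i j x, U i x -> U j x -> i = j) -> (forall i, U i `<=` W) ->
  \sum_i tvr (U i) <= tvr W.
Proof.
move=> dU UW; apply/ler_addgt0Pl => e e0.
(* The successor covers an empty [I]. The chosen fields live in disjoint sets, so at each point at
   most one is nonzero and their sum is still bounded by 1. *)
pose d := e / #|I|.+1%:R; have d0 : 0 < d by rewrite divr_gt0.
have /choice[v hv] i : exists v, [/\ test_field (U i) v,
    (forall x, enorm (v x) <= 1) & tvr (U i) - d < pairing (divergence v)].
  by have [v [? ?] ?] := tvr_attained (U i) d0; exists v.
have tv i : test_field (U i) (v i) by have [] := hv i.
have tV : test_field W (fun x => \sum_i v i x) by exact: test_field_sum tv UW.
have b1 x : enorm (\sum_i v i x) <= 1.
  have [[i Uix]|nU] := pselect (exists i, U i x).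
    rewrite (bigD1 i)//= big1 ?addr0; first by have [_ ->] := hv i.
    move=> j ji; apply: (test_field_eq0 (tv j)) => Ujx.
    by move/eqP: ji; apply; exact: dU Ujx Uix.
  rewrite big1 ?enorm0// => i _; apply: (test_field_eq0 (tv i)) => Uix.
  by apply: nU; exists i.
have := pairing_le_tvr ltr01 tV b1; rewrite mul1r.
have -> : pairing (divergence (fun x => \sum_i v i x)) =
    \sum_i pairing (divergence (v i)).
  rewrite -pairing_sum; last by move=> i; exact: integrable_divergence (tv i).
  congr pairing; apply/funext => x.
  by rewrite divergence_sum// => i; have [] := tv i.
move=> h; apply: le_trans (lerD (lexx e) h).
rewrite -lerBlDl; apply: (@le_trans _ _ (\sum_i (tvr (U i) - d))).
  rewrite sumrB lerD2l lerN2 sumr_const -mulr_natr /d -mulrA.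
  apply: ler_piMr; first exact: ltW.
  by rewrite mulrC ler_pdivrMr// mul1r ler_nat.
by apply: ler_sum => i _; rewrite ltW//; have [] := hv i.
Qed.

End variation.

(** * Dyadic cubes *)

Section dyadic.
Context {R : realType} {n : nat}.
Let mu := @lebesgue_rV R n.
Implicit Types (o x : 'rV[R]_n) (L l : R) (E : set 'rV[R]_n).

Definition child o L (e : {ffun 'I_n -> bool}) : 'rV[R]_n :=
  \row_i (o ord0 i + (e i)%:R * (L / 2)).

Lemma childE o L e i : child o L e ord0 i = o ord0 i + (e i)%:R * (L / 2).
Proof. by rewrite mxE. Qed.

Lemma child_bounds o L e i : 0 < L ->
  o ord0 i <= child o L e ord0 i /\
  child o L e ord0 i + L / 2 <= o ord0 i + L.
Proof. by move=> L0; rewrite childE; case: (e i); rewrite /= ?mul1r ?mul0r; split; lra. Qed.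

Lemma hbox_child_sub o L e : 0 < L -> hbox (child o L e) (L / 2) `<=` hbox o L.
Proof.
move=> L0 x hx i; have := hx i; have [] := child_bounds o e i L0; lra.
Qed.

Lemma obox_child_sub o L e : 0 < L -> obox (child o L e) (L / 2) `<=` obox o L.
Proof.
move=> L0 x hx i; have := hx i; have [] := child_bounds o e i L0; lra.
Qed.

Lemma obox_hbox o L : obox o L `<=` hbox o L.
Proof. by move=> x hx i; have := hx i; lra. Qed.

Lemma hbox_child_inj o L e e' x : hbox (child o L e) (L / 2) x ->
  hbox (child o L e') (L / 2) x -> e = e'.
Proof.
move=> hx hx'; apply/ffunP => i.
have := hx i; have := hx' i; rewrite !childE.
by case: (e i); case: (e' i) => //=; lra.
Qed.

Lemma hbox_child_cover o L x : hbox o L x -> exists e, hbox (child o L e) (L / 2) x.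
Proof.
move=> hx; exists [ffun i => o ord0 i + L / 2 <= x ord0 i] => i.
have := hx i; rewrite childE ffunE.
by case: (leP (o ord0 i + L / 2) (x ord0 i)) => h; rewrite /= ?mul1r ?mul0r; lra.
Qed.

Lemma measurable_hbox o L : measurable (hbox o L).
Proof.
rewrite (_ : hbox o L = \bigcap_(i in [set: 'I_n])
    ((fun x : 'rV[R]_n => x ord0 i : measurableTypeR R) @^-1`
      `[o ord0 i, (o ord0 i + L)[%classic)).
  apply: fin_bigcap_measurable => // i _.
  by rewrite -[X in measurable X]setTI; exact: measurable_coor.
apply/seteqP; split => x /= hx i; first by move=> _; rewrite /= in_itv /=; exact: hx.
by have := hx i I; rewrite /= in_itv.
Qed.

Lemma lebesgue_hbox o L : 0 <= L -> mu (hbox o L) = (L ^+ n)%:E.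
Proof.
move=> L0.
pose A (i : 'I_n) : set (measurableTypeR R) := `[o ord0 i, o ord0 i + L[%classic.
have mA i : measurable (A i) by exact: measurable_itv.
have hE : hbox o L = [set x | forall i, A i (x ord0 i)].
  by apply/seteqP; split => x hx i; have := hx i; rewrite /A /= in_itv.
have -> : mu (hbox o L) = (\prod_(i < n) lebesgue_measure (A i))%E.
  by rewrite hE; exact: lebesgue_rV_prod.
rewrite (eq_bigr (fun _ => L%:E)); last first.
  move=> i _; rewrite lebesgue_measure_itv /= lte_fin.
  case: ifPn; first by rewrite -EFinB addrAC subrr add0r.
  by rewrite ltrDl -leNgt => L0'; congr EFin; apply/eqP; rewrite eq_le L0 L0'.
by rewrite prodEFin prodr_const card_ord.
Qed.

Definition vol E : R := fine (mu E).

Lemma vol_fin E o L : 0 <= L -> measurable E -> E `<=` hbox o L ->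
  mu E \is a fin_num.
Proof.
move=> L0 mE EL; rewrite ge0_fin_numE//.
apply: (@le_lt_trans _ _ (mu (hbox o L))).
  by rewrite le_measure// inE//; exact: measurable_hbox.
by rewrite lebesgue_hbox// ltry.
Qed.

Lemma vol_ge0 E : 0 <= vol E. Proof. exact: fine_ge0. Qed.

Lemma vol_le E F : measurable E -> measurable F -> mu F \is a fin_num ->
  E `<=` F -> vol E <= vol F.
Proof.
move=> mE mF fF EF; rewrite /vol fine_le//; last by rewrite le_measure// inE.
rewrite ge0_fin_numE//; apply: le_lt_trans (le_measure mu _ _ EF) _; rewrite ?inE//.
by rewrite ltey_eq fF.
Qed.

Lemma vol_hbox o L : 0 <= L -> vol (hbox o L) = L ^+ n.
Proof. by move=> L0; rewrite /vol lebesgue_hbox. Qed.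

(* Union of the boxes of the [k]-th dyadic generation of [hbox o L] that are
   contained in [E]. *)
Fixpoint fill E k o L : set 'rV[R]_n :=
  if k is k'.+1 then \bigcup_e fill E k' (child o L e) (L / 2)
  else [set x | hbox o L x /\ hbox o L `<=` E].

Lemma fill_sub_hbox E k o L : 0 < L -> fill E k o L `<=` hbox o L.
Proof.
elim: k o L => [|k IH] o L L0 x; first by case.
by move=> [e _ /IH h]; apply: (@hbox_child_sub _ _ e) => //; apply: h; lra.
Qed.

Lemma fill_sub E k o L : fill E k o L `<=` E.
Proof.
elim: k o L => [|k IH] o L x; first by case=> hx; exact.
by move=> [e _ /IH].
Qed.

Lemma fill0E E o L : hbox o L `<=` E -> fill E 0 o L = hbox o L.
Proof. by move=> h; apply/seteqP; split => x //=; case. Qed.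

Lemma fill0_eq0 E o L : ~ hbox o L `<=` E -> fill E 0 o L = set0.
Proof. by move=> h; apply/seteqP; split => x //= []. Qed.

Lemma measurable_fill E k o L : measurable (fill E k o L).
Proof.
elim: k o L => [|k IH] o L.
  have [h|h] := pselect (hbox o L `<=` E).
    by rewrite fill0E//; exact: measurable_hbox.
  by rewrite fill0_eq0.
apply: fin_bigcup_measurable => //; exact: finite_finset.
Qed.

Lemma fill_fin E k o L : 0 < L -> mu (fill E k o L) \is a fin_num.
Proof.
move=> L0; apply: (@vol_fin _ o L); first exact: ltW.
- exact: measurable_fill.
- exact: fill_sub_hbox.
Qed.

Lemma vol_fillS E k o L : 0 < L ->
  vol (fill E k.+1 o L) = \sum_e vol (fill E k (child o L e) (L / 2)).
Proof.
move=> L0; have L20 : 0 < L / 2 by lra.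
rewrite /vol /= (_ : \bigcup_e _ =
  \bigcup_(e in [set` index_enum {ffun 'I_n -> bool}]) fill E k (child o L e) (L / 2)); last first.
  apply/seteqP; split => x [e _ h]; exists e => //=.
  by rewrite mem_index_enum.
rewrite measure_fin_bigcup//=.
- rewrite -fsbig_seq ?index_enum_uniq//= sum_fine// => e _; exact: fill_fin.
- move=> e e' _ _ [x [/fill_sub_hbox h /fill_sub_hbox h']].
  by apply: hbox_child_inj (h _) (h' _).
- by move=> e _; exact: measurable_fill.
Qed.

Lemma fill_mono E k o L : 0 < L -> fill E k o L `<=` fill E k.+1 o L.
Proof.
elim: k o L => [|k IH] o L L0 x.
  move=> [hx hE]; have [e he] := hbox_child_cover hx.
  by exists e => //; split=> // y hy; apply: hE; exact: (@hbox_child_sub _ _ e).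
by move=> [e _ /IH h]; exists e => //; apply: h; lra.
Qed.

Lemma fill_near E k o L x : 0 < L -> hbox o L x ->
  (forall y : 'rV[R]_n, (forall i, `|x ord0 i - y ord0 i| < L / 2 ^+ k) -> E y) ->
  fill E k o L x.
Proof.
elim: k o L => [|k IH] o L L0 hx xE.
  split=> // y hy; apply: xE => i; rewrite expr0 divr1.
  by have := hx i; have := hy i; rewrite ltr_norml => *; apply/andP; split; lra.
have [e he] := hbox_child_cover hx.
exists e => //; apply: IH => //; first by lra.
by move=> y hy; apply: xE => i; rewrite exprS invfM mulrA.
Qed.

(** As [E] is open, a small enough dyadic box around each of its points lies in [E]; the sets
    [fill E k o L] increase to [E], and the measure is continuous from below. *)
Lemma fill_exhaust E o L (c : R) : 0 < L -> open E -> E `<=` hbox o L ->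
  c < vol E -> exists k, c < vol (fill E k o L).
Proof.
move=> L0 oE EL cE.
have mE := open_measurable_rV oE.
have UE : \bigcup_k fill E k o L = E.
  apply/seteqP; split => [x [k _ /fill_sub]//|x Ex].
  have /nbhs_ballP[r /= r0 xr] := open_nbhs_nbhs (conj oE Ex).
  have [k kr] : exists k, L / 2 ^+ k < r.
    have := @cvg_geometric R L 2^-1; rewrite ger0_norm ?invr_ge0// => /(_ _)/wrap[].
      lra.
    move=> /cvgrPdist_lt /(_ _ r0)[k _ /(_ k (leqnn k))].
    rewrite /= sub0r normrN /geometric /= exprVn ger0_norm; last first.
      by rewrite divr_ge0 ?ltW// exprn_gt0.
    by exists k.
  exists k => //; apply: fill_near => //; first exact: EL.
  by move=> y hy; apply: xr; split=> // i j; rewrite [i]ord1; exact: lt_trans (hy j) kr.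
have nd : nondecreasing_seq (fun k => fill E k o L).
  apply/nondecreasing_seqP => k; apply/subsetPset; exact: fill_mono.
have := @nondecreasing_cvg_mu _ _ _ mu (fun k => fill E k o L)
  (fun k => measurable_fill _ _ _ _).
rewrite UE => /(_ mE nd) cv.
have fE : mu E \is a fin_num by exact: vol_fin (ltW L0) mE EL.
have : (c%:E < mu E)%E by rewrite -(fineK fE) lte_fin.
move=> cmu.
have oc : open [set y | (c%:E < y)%E] by exact: open_ereal_gt_ereal.
have := cv _ (open_nbhs_nbhs (conj oc cmu)).
move=> [k _ /(_ k (leqnn k))] /=.
rewrite -(fineK (fill_fin _ k o L0)) lte_fin => h.
by exists k.
Qed.

End dyadic.

(** * Transport through the dyadic scales *)

Section dyadic_cost.
Context {R : realType}.
Implicit Types (n k : nat) (e r L : R).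

(** The price, per unit of total variation and up to a constant, of raising the filled volume by k
    generations: a child of side l = L / 2 holds at most min(e, l^n), and its field has size volume
    / l^(n-1). The recursion follows a single child because the variations of all the children sum
    to at most that of the parent. *)
Fixpoint cost n e k L : R :=
  if k is k'.+1 then
    cost n e k' (L / 2) + Num.min e ((L / 2) ^+ n) / (L / 2) ^+ n.-1
  else 0.

Lemma cost_le n e k L : (0 < n)%N -> 0 < L -> cost n e k L <= L.
Proof.
move=> n0; elim: k L => [|k IH] L L0 /=; first exact: ltW.
have l0 : 0 < L / 2 by lra.
have := IH _ l0.
suff : Num.min e ((L / 2) ^+ n) / (L / 2) ^+ n.-1 <= L / 2 by lra.
rewrite ler_pdivrMr ?exprn_gt0// -exprS prednK//.
by rewrite ge_min lexx orbT.
Qed.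

(** The subtracted term makes the induction close: for r <= L/2 the last jump costs at most r^2 /
    (L/2), as n >= 2, which is exactly the increase of the bound from L/2 to L. For r <= L < 2r the
    bound L on the whole cost suffices, because (L - r)(L - 2r) <= 0. *)
Lemma cost_le_coarse n r k L : (1 < n)%N -> 0 < r -> r <= L ->
  cost n (r ^+ n) k L <= 3 * r - 2 * r ^+ 2 / L.
Proof.
move=> n1 r0; elim: k L => [|k IH] L rL /=.
  have L0 : 0 < L := lt_le_trans r0 rL.
  by rewrite subr_ge0 ler_pdivrMr//; nra.
have L0 : 0 < L := lt_le_trans r0 rL.
have l0 : 0 < L / 2 by lra.
have [rl|lr] := leP r (L / 2).
  have h1 : Num.min (r ^+ n) ((L / 2) ^+ n) / (L / 2) ^+ n.-1 <= 2 * r ^+ 2 / L.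
    apply: (@le_trans _ _ (r ^+ n / (L / 2) ^+ n.-1)).
      by rewrite ler_wpM2r ?invr_ge0 ?exprn_ge0 ?(ltW l0)// ge_min lexx.
    rewrite ler_pdivrMr ?exprn_gt0//.
    clear IH; case: n n1 => [|[|m]]// _ /=.
    have -> : 2 * r ^+ 2 / L * (L / 2) ^+ m.+1 = r ^+ 2 * (L / 2) ^+ m.
      by rewrite [(L / 2) ^+ m.+1]exprS; move: ((L / 2) ^+ m) => z; field; rewrite gt_eqF.
    rewrite -addn2 addnC exprD ler_wpM2l ?exprn_ge0 ?(ltW r0)//.
    by rewrite lerXn2r// nnegrE ltW.
  have := IH _ rl.
  have -> : 2 * r ^+ 2 / (L / 2) = 2 * (2 * r ^+ 2 / L) by field; rewrite gt_eqF.
  by move: h1; lra.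
have n0 : (0 < n)%N by exact: ltnW.
have h1 : Num.min (r ^+ n) ((L / 2) ^+ n) / (L / 2) ^+ n.-1 <= L / 2.
  rewrite ler_pdivrMr ?exprn_gt0// -exprS prednK//.
  by rewrite ge_min lexx orbT.
have h2 := @cost_le n (r ^+ n) k _ n0 l0.
suff : 2 * r ^+ 2 / L <= 3 * r - L by move: h1 h2; lra.
by rewrite ler_pdivrMr//; nra.
Qed.

End dyadic_cost.

Section jump.
Context {R : realType} {n : nat}.
Let mu := @lebesgue_rV R n.
Variable w : 'rV[R]_n -> R.
Hypothesis iw : mu.-integrable setT (EFin \o w).
Hypothesis fw : (total_variation w setT < +oo)%E.
Variable cb : R.
Hypothesis cb1 : 1 <= cb.
Hypothesis bump_cb : forall t, bump t <= cb.
Hypothesis n_gt0 : (0 < n)%N.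
Implicit Types (o x : 'rV[R]_n) (L l : R) (E : set 'rV[R]_n).
Local Notation eps := {ffun 'I_n -> bool}.

Lemma bbox_le o l x : 0 < l -> bbox o l x <= (cb / l) ^+ n.
Proof.
move=> l0; have -> : (cb / l) ^+ n = \prod_(i < n) (cb / l).
  by rewrite prodr_const card_ord.
apply: ler_prod => i _; rewrite sbump_ge0//= /sbump mulrC.
by rewrite ler_wpM2r// invr_ge0 ltW.
Qed.

Lemma pairable_bbox o l : 0 < l -> pairable w (bbox o l).
Proof.
move=> l0; apply: (integrable_mul_bounded iw (c := (cb / l) ^+ n)).
  by apply: continuous_measurable_rV; exact: continuous_bbox.
by move=> x; rewrite ger0_norm ?bbox_ge0// bbox_le.
Qed.

Definition density o l : R := pairing w (bbox o l).

Definition spread (L : R) (c : eps -> R) o x : 'rV[R]_n :=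
  \sum_e c e *: transport o L (child o L e) (L / 2) x.

Lemma test_field_spread o L c : 0 < L -> test_field (obox o L) (spread L c o).
Proof.
move=> L0; apply: (@test_field_sum _ _ _ (fun=> obox o L)) => // e; last exact: subset_refl.
apply: test_fieldZ.
apply: (@test_fieldP _ _ _ (cbox o (L / 2 / 4) (L - L / 2 / 4))).
- by move=> i; exact: smooth_transport.
- exact: compact_cbox.
- by move=> x hx i; have := hx i; lra.
- move=> x; apply: transport_support; [lra|lra|].
  by move=> i; exact: child_bounds.
Qed.

Lemma pairing_spread o L c : 0 < L -> pairing w (divergence (spread L c o)) =
  \sum_e c e * density (child o L e) (L / 2) - (\sum_e c e) * density o L.
Proof.
move=> L0; have l0 : 0 < L / 2 by lra.
rewrite -[RHS]addr0 mulr_suml -sumrB addr0.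
have -> : divergence (spread L c o) = (fun x => \sum_e c e *
    (bbox (child o L e) (L / 2) x + (- 1) * bbox o L x)).
  apply/funext => x; rewrite /spread divergence_sum.
    apply: eq_bigr => e _; rewrite (@divergenceZ _ _ (obox o L)).
      by rewrite divergence_transport mulN1r.
    apply: (@test_fieldP _ _ _ (cbox o (L / 2 / 4) (L - L / 2 / 4))).
    - by move=> i; exact: smooth_transport.
    - exact: compact_cbox.
    - by move=> y hy i; have := hy i; lra.
    - move=> y; apply: transport_support; [lra|lra|].
      by move=> i; exact: child_bounds.
  move=> e i; under eq_fun do rewrite mxE.
  by apply: smoothM_cst; exact: smooth_transport.
have p1 e : pairable w (bbox (child o L e) (L / 2)) by exact: pairable_bbox.
have p2 : pairable w (fun x => (- 1) * bbox o L x).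
  by apply: pairableZ; exact: pairable_bbox.
have p3 e : pairable w (fun x => bbox (child o L e) (L / 2) x + (- 1) * bbox o L x).
  exact: (pairableD (p1 e) p2).
rewrite pairing_sum; last by move=> e; apply: pairableZ; exact: p3.
apply: eq_bigr => e _; rewrite pairingZ; last exact: p3.
rewrite -mulrBr; congr (_ * _).
rewrite (pairingD (p1 e) p2) pairingZ; last exact: pairable_bbox.
by rewrite mulN1r.
Qed.

(** The factor n bounds the Euclidean norm by the sum of the coordinates, 2^n counts the children,
    and each of the n - 1 bumps in a component contributes [cb]. *)
Definition jump_const : R := n%:R * (2 ^ n)%:R * cb ^+ n.-1.

Lemma jump_const_gt0 : 0 < jump_const.
Proof.
by rewrite /jump_const !mulr_gt0 ?exprn_gt0 ?ltr0n ?expn_gt0//; apply: lt_le_trans cb1.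
Qed.

Lemma enorm_spread o L c M x : 0 < L -> (forall e, 0 <= c e <= M) ->
  enorm (spread L c o x) <= jump_const * (M / (L / 2) ^+ n.-1).
Proof.
move=> L0 cM; have l0 : 0 < L / 2 by lra.
apply: le_trans (enorm_le_sum _) _.
apply: (@le_trans _ _ (\sum_(i < n) (2 ^ n)%:R * (M * (cb / (L / 2)) ^+ n.-1))).
  apply: ler_sum => i _; rewrite summxE.
  apply: le_trans (ler_norm_sum _ _ _) _.
  apply: (@le_trans _ _ (\sum_(e : eps) M * (cb / (L / 2)) ^+ n.-1)).
    apply: ler_sum => e _; rewrite mxE normrM.
    have /andP[c0 cMe] := cM e; rewrite ger0_norm//.
    apply: ler_pM => //; apply: transport_le => //; lra.
  rewrite sumr_const -[X in X <= _]mulr_natl.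
  by rewrite card_ffun card_bool card_ord.
rewrite sumr_const card_ord -[X in X <= _]mulr_natl /jump_const exprMn exprVn.
by rewrite le_eqVlt; apply/orP; left; apply/eqP; ring.
Qed.

Lemma jump o L c M : 0 < L -> 0 < M -> (forall e, 0 <= c e <= M) ->
  `|\sum_e c e * density (child o L e) (L / 2) - (\sum_e c e) * density o L|
  <= jump_const * (M / (L / 2) ^+ n.-1) * tvr w (obox o L).
Proof.
move=> L0 M0 cM; rewrite -pairing_spread//.
have tV := test_field_spread o c L0.
have k0 : 0 < jump_const * (M / (L / 2) ^+ n.-1).
  by rewrite mulr_gt0 ?jump_const_gt0// divr_gt0// exprn_gt0//; lra.
have b x := enorm_spread o x L0 cM.
rewrite ler_norml; apply/andP; split; last exact: pairing_le_tvr.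
rewrite lerNl -mulN1r -pairingZ; last exact: (integrable_divergence iw tV).
have tN := test_fieldZ (- 1) tV.
rewrite [leLHS](_ : _ = pairing w (divergence (fun x => (- 1) *: spread L c o x))).
  by apply: pairing_le_tvr => // x; rewrite enormZ normrN1 mul1r.
by congr pairing; apply/funext => x; rewrite (divergenceZ _ _ tV).
Qed.

(** The sign [s] and the threshold [kappa] let one induction serve twice: with s = 1 and kappa > 0
    where w = 1, and with s = -1 and kappa = 0 where w = 0. A box of generation 0 contained in [E]
    has density beyond the threshold, so the left side starts nonpositive, and each generation adds
    one [jump]. *)
Lemma fill_transport E (e s kappa : R) : 0 < e -> `|s| = 1 ->
  (forall o l, 0 < l -> hbox o l `<=` E -> kappa <= s * density o l) ->
  (forall k o l, 0 < l -> vol (fill E k o l) <= e) ->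
  forall k o L, 0 < L ->
  vol (fill E k o L) * (kappa - s * density o L) <=
  jump_const * cost n e k L * tvr w (obox o L).
Proof.
move=> e0 s1 Ek Ee; elim=> [|k IH] o L L0.
  rewrite [cost _ _ _ _]/= mulr0 mul0r.
  have [h|h] := pselect (hbox o L `<=` E); last first.
    by rewrite fill0_eq0// /vol measure0 mul0r.
  by rewrite fill0E// mulr_ge0_le0 ?vol_ge0// subr_le0; exact: Ek.
have l0 : 0 < L / 2 by lra.
set T := tvr w (obox o L).
have T0 : 0 <= T by exact: tvr_ge0.
pose m (i : eps) := vol (fill E k (child o L i) (L / 2)).
pose J (i : eps) := density (child o L i) (L / 2).
have cost0 : 0 <= cost n e k (L / 2).
  elim: (k) (L / 2) l0 => //= k' IH' l l0; have l20 : 0 < l / 2 by lra.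
  rewrite addr_ge0 ?IH'// divr_ge0 ?exprn_ge0 ?(ltW l20)//.
  by rewrite le_min (ltW e0) exprn_ge0// ltW.
have J0 : 0 <= jump_const := ltW jump_const_gt0.
have h1 : \sum_i m i * (kappa - s * J i) <= jump_const * cost n e k (L / 2) * T.
  apply: (@le_trans _ _ (\sum_i jump_const * cost n e k (L / 2) *
      tvr w (obox (child o L i) (L / 2)))).
    by apply: ler_sum => i _; exact: IH.
  rewrite -mulr_sumr; apply: ler_wpM2l; first exact: mulr_ge0.
  apply: (tvr_superadditive iw fw) => [i j x|i].
    by move=> /obox_hbox hi /obox_hbox hj; exact: hbox_child_inj hi hj.
  exact: obox_child_sub.
pose M := Num.min e ((L / 2) ^+ n).
have M0 : 0 < M by rewrite lt_min e0 exprn_gt0.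
have mM i : 0 <= m i <= M.
  rewrite vol_ge0 le_min Ee//=.
  rewrite -(vol_hbox (child o L i) (ltW l0)) vol_le//.
  - exact: measurable_fill.
  - exact: measurable_hbox.
  - apply: (@vol_fin _ _ _ (child o L i) (L / 2)); [exact: ltW|exact: measurable_hbox|by []].
  - exact: fill_sub_hbox.
have := jump o L0 M0 mM.
rewrite -[X in _ <= X]mul1r -[X in X * (_ * _)]s1.
rewrite -/T => h2.
rewrite vol_fillS// -/(m _) [cost _ _ _ _]/= -/M.
have h3 : s * (\sum_i m i * J i - (\sum_i m i) * density o L) <=
    jump_const * (M / (L / 2) ^+ n.-1) * T.
  apply: le_trans (ler_norm _) _; rewrite normrM.
  by move: h2; rewrite s1 !mul1r.
(* Each child is first compared with its own density, by induction; replacing the densities of the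
   children by that of the parent, with weights [m], is the error controlled by [jump]. *)
have -> : (\sum_i m i) * (kappa - s * density o L) =
   \sum_i m i * (kappa - s * J i) +
   s * (\sum_i m i * J i - (\sum_i m i) * density o L).
  have -> : \sum_i m i * (kappa - s * J i) =
      (\sum_i m i) * kappa - s * \sum_i m i * J i.
    rewrite mulr_suml mulr_sumr -sumrB; apply: eq_bigr => i _; ring.
  ring.
by rewrite [jump_const * (_ + _)]mulrDr mulrDl; exact: lerD.
Qed.

End jump.

(** * Smoothed densities of boxes *)

Section box_densities.
Context {R : realType} {n : nat}.
Let mu := @lebesgue_rV R n.
Implicit Types (o x : 'rV[R]_n) (L l : R) (E : set 'rV[R]_n).

Lemma integrable_indic_hbox o l (c : R) : 0 < l ->
  mu.-integrable setT (EFin \o (fun x => c * \1_(hbox o l) x)).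
Proof.
move=> l0; have mh := @measurable_hbox R n o l.
have h : mu.-integrable setT (EFin \o \1_(hbox o l)).
  apply/integrableP; split; first exact/measurable_EFinP/measurable_indic.
  under eq_integral do rewrite /= ger0_norm//.
  rewrite integral_indic// setIT.
  have h : (mu (hbox o l) < +oo)%E by rewrite lebesgue_hbox ?ltry// ltW.
  exact: h.
have := @integrableZl _ _ _ mu setT measurableT c _ h.
by congr (is_true (integrable _ _ _)); apply/funext => x.
Qed.

Lemma Rintegral_indic_hbox o l (c : R) : 0 < l ->
  (\int[mu]_x (c * \1_(hbox o l) x))%R = c * l ^+ n.
Proof.
move=> l0; have mh := @measurable_hbox R n o l.
rewrite RintegralZl//; last first.
  have := integrable_indic_hbox o 1 l0.
  by congr (is_true (integrable _ _ _)); apply/funext => x /=; rewrite mul1r.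
congr (_ * _); rewrite /Rintegral integral_indic// setIT.
exact: (vol_hbox o (ltW l0)).
Qed.

Lemma integrable_bbox o l : 0 < l -> mu.-integrable setT (EFin \o bbox o l).
Proof.
move=> l0; have [cb cb1 hcb] := @bump_bounded R.
apply: le_integrable (integrable_indic_hbox o ((cb / l) ^+ n) l0) => //.
  apply/measurable_EFinP; apply: continuous_measurable_rV.
  exact: continuous_bbox.
move=> x _ /=; rewrite lee_fin ger0_norm ?bbox_ge0// ger0_norm; last first.
  by rewrite mulr_ge0// exprn_ge0// divr_ge0// ?(ltW l0)// (le_trans _ cb1).
rewrite indicE; case: (boolP (x \in hbox o l)) => [_|/negP].
  by rewrite mulr1; exact: bbox_le.
rewrite inE => hx; rewrite bbox_eq0 ?mulr0// => /obox_hbox; exact: hx.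
Qed.

(** On the middle third of the box every factor is at least c / l, and the volume of that third is
    (l / 3)^n: the powers of l cancel, and the bound is independent of the box. *)
Lemma integral_bbox_ge : exists2 kappa : R, 0 < kappa &
  forall o l, 0 < l -> kappa <= (\int[mu]_x bbox o l x)%R.
Proof.
have [c c0 hc] := @bump_lower R.
exists ((c / 3) ^+ n); first by rewrite exprn_gt0// divr_gt0.
move=> o l l0; have l30 : 0 < l / 3 by lra.
pose o' : 'rV[R]_n := \row_i (o ord0 i + l / 3).
have -> : (c / 3) ^+ n = (\int[mu]_x ((c / l) ^+ n * \1_(hbox o' (l / 3)) x))%R.
  rewrite Rintegral_indic_hbox// -exprMn; congr (_ ^+ n).
  by field; rewrite gt_eqF.
apply: le_Rintegral => //.
- exact: integrable_indic_hbox.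
- exact: integrable_bbox.
move=> x _; rewrite indicE; case: (boolP (x \in hbox o' (l / 3))) => [|_]; last first.
  by rewrite mulr0 bbox_ge0.
rewrite inE mulr1 => hx.
have -> : (c / l) ^+ n = \prod_(i < n) (c / l).
  by rewrite prodr_const card_ord.
apply: ler_prod => i _; apply/andP; split; first by rewrite divr_ge0// ltW.
rewrite /sbump mulrC ler_wpM2l ?invr_ge0 ?(ltW l0)//.
apply: hc; have := hx i; rewrite mxE => /andP[h1 h2].
have -> : l^-1 * x ord0 i - o ord0 i / l = (x ord0 i - o ord0 i) / l.
  by rewrite mulrBl mulrC.
by rewrite ler_pdivlMr// ler_pdivrMr//; apply/andP; split; lra.
Qed.

Variable w : 'rV[R]_n -> R.
Hypothesis iw : mu.-integrable setT (EFin \o w).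

Lemma density_eq_integral E o l (a : R) : 0 < l -> hbox o l `<=` E ->
  ae_eq mu E w (cst a) -> density w o l = a * (\int[mu]_x bbox o l x)%R.
Proof.
move=> l0 hE wa; rewrite -RintegralZl//; last exact: integrable_bbox.
have [cb cb1 hcb] := @bump_bounded R.
rewrite /density /pairing /Rintegral; congr fine.
apply: ae_eq_integral => //.
- exact: measurable_int (pairable_bbox iw hcb o l0).
- apply/measurable_EFinP; apply: measurable_funM => //.
  by apply: continuous_measurable_rV; exact: continuous_bbox.
apply: filterS wa => x wx _ /=; congr EFin.
have [/hE/wx -> //|hx] := pselect (hbox o l x).
by rewrite bbox_eq0 ?mulr0// => /obox_hbox.
Qed.

(** Integrability of [w] makes the density of a huge box negligible; this is how the isoperimetric
    inequality gets a reference value close to 0. *)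
Lemma norm_density_le (cb : R) o l : 1 <= cb -> (forall t, bump t <= cb) ->
  0 < l -> `|density w o l| <= (cb / l) ^+ n * (\int[mu]_x `|w x|)%R.
Proof.
move=> cb1 hcb l0; have pw := pairable_bbox iw hcb o l0.
apply: le_trans (le_normr_Rintegral measurableT pw) _.
have iaw : mu.-integrable setT (EFin \o (fun x => `|w x|)).
  exact: integrable_norm.
rewrite -RintegralZl//; apply: le_Rintegral => //.
- exact: integrable_norm pw.
- exact: (@integrableZl _ _ _ mu setT measurableT ((cb / l) ^+ n) _ iaw).
move=> x _; rewrite normrM mulrC ler_wpM2r// ger0_norm ?bbox_ge0//.
exact: bbox_le.
Qed.

End box_densities.

(** * Isoperimetric and Poincaré inequalities *)

Section functional_inequalities.
Context {R : realType} {n : nat}.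
Let mu := @lebesgue_rV R n.
Hypothesis n_gt1 : (1 < n)%N.
Let n_gt0 : (0 < n)%N := ltnW n_gt1.
Implicit Types (w : 'rV[R]_n -> R) (o x : 'rV[R]_n) (L l : R) (E : set 'rV[R]_n).

Lemma vol_fill_le E k o l o' L : 0 < l -> 0 < L -> open E -> E `<=` hbox o' L ->
  vol (fill E k o l) <= vol E.
Proof.
move=> l0 L0 oE EL; have mE := open_measurable_rV oE.
apply: vol_le => //; first exact: measurable_fill.
- exact: vol_fin (ltW L0) mE EL.
- exact: fill_sub.
Qed.

Lemma hbox_sub o L L' : L <= L' -> hbox o L `<=` hbox o L'.
Proof. by move=> LL x hx i; have := hx i; lra. Qed.

Lemma root_exists (e : R) : 0 < e -> exists2 r : R, 0 < r & r ^+ n = e.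
Proof.
move=> e0; exists (e `^ (n%:R^-1)); first exact: powR_gt0.
rewrite -powR_mulrn ?powR_ge0// -powRrM mulVf ?powRr1// ?ltW//.
by rewrite pnatr_eq0 -lt0n.
Qed.

(** Half of the volume of [E] is transported from density at least kappa to density at most kappa /
    2, at cost at most 3r with r^n = |E|; this gives the factor 12 = 2 * 2 * 3. In the n-th power of
    the result, r^n cancels one factor |E|. *)
Lemma isoperimetric : exists2 C : R, 0 < C & forall w E o L,
  mu.-integrable setT (EFin \o w) -> (total_variation w setT < +oo)%E ->
  0 < L -> open E -> E `<=` hbox o L -> 0 < vol E -> ae_eq mu E w (cst 1) ->
  vol E ^+ n.-1 <= (C * tvr w setT) ^+ n.
Proof.
have [cb cb1 hcb] := @bump_bounded R.
have [kappa kappa0 hkappa] := @integral_bbox_ge R n.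
pose J := jump_const (n := n) cb.
have J0 : 0 < J by exact: jump_const_gt0.
exists (12 * J / kappa); first by rewrite divr_gt0// mulr_gt0.
move=> w E o L iw fw L0 oE EL E0 w1.
have [r r0 rE] := root_exists E0.
set I := (\int[mu]_x `|w x|)%R.
have I0 : 0 <= I by apply: Rintegral_ge0.
(* Each summand serves one bound: [E] stays in the box, r <= L', cb / L' <= 1, and the density of
   the large box is at most kappa / 2. [I + 1] is positive even if w = 0 almost everywhere. *)
pose L' := L + r + cb + 2 * cb * (I + 1) / kappa.
have cb0 : 0 < cb by apply: lt_le_trans cb1.
have q0 : 0 < 2 * cb * (I + 1) / kappa.
  by rewrite divr_gt0// !mulr_gt0// ltr_wpDl.
have LL' : L <= L' by rewrite /L'; lra.
have L'0 : 0 < L' by exact: lt_le_trans LL'.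
have EL' : E `<=` hbox o L' by move=> x /EL; exact: hbox_sub.
have dens : `|density w o L'| <= kappa / 2.
  apply: le_trans (norm_density_le iw o cb1 hcb L'0) _; rewrite -/I.
  have h1 : (cb / L') ^+ n <= cb / L'.
    rewrite -[leRHS]expr1; apply: ler_wiXn2l => //; first by rewrite divr_ge0// ltW.
    by rewrite ler_pdivrMr// mul1r /L'; lra.
  apply: (@le_trans _ _ (cb / L' * (I + 1))).
    by apply: ler_pM => //; rewrite ?lerDl// exprn_ge0// divr_ge0// ltW.
  rewrite mulrAC ler_pdivrMr//.
  have : 2 * cb * (I + 1) / kappa <= L' by rewrite /L'; lra.
  by rewrite ler_pdivrMr// => h2; nra.
have half : vol E / 2 < vol E by lra.
have [k hk] := fill_exhaust L'0 oE EL' half.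
have dE o' l : 0 < l -> hbox o' l `<=` E -> kappa <= 1 * density w o' l.
  move=> l0 hE; rewrite mul1r (density_eq_integral iw l0 hE w1) mul1r.
  exact: hkappa.
have fle k' o' l : 0 < l -> vol (fill E k' o' l) <= vol E.
  by move=> l0; exact: vol_fill_le l0 L'0 oE EL'.
have := fill_transport iw fw cb1 hcb n_gt0 E0 (normr1 R) dE fle k o L'0.
rewrite mul1r -/J => main.
set T := tvr w setT.
have T0 : 0 <= T by exact: tvr_ge0.
have rL' : r <= L' by rewrite /L'; lra.
have hcost : cost n (vol E) k L' <= 3 * r.
  rewrite -rE; apply: le_trans (cost_le_coarse k n_gt1 r0 rL') _.
  by rewrite lerBlDr lerDl divr_ge0 ?(ltW L'0)// mulr_ge0// exprn_ge0// ltW.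
have h1 : vol (fill E k o L') * (kappa - density w o L') <= J * (3 * r) * T.
  apply: le_trans main _; apply: (@le_trans _ _ (J * (3 * r) * tvr w (obox o L'))).
    by rewrite ler_wpM2r ?tvr_ge0// ler_wpM2l// ltW.
  apply: ler_wpM2l; first by apply: mulr_ge0; [exact: ltW|lra].
  exact: (tvr_mono iw fw).
have h2 : vol E / 2 * (kappa / 2) <= vol (fill E k o L') * (kappa - density w o L').
  apply: ler_pM; [lra|lra|exact: ltW|].
  by move: dens; rewrite ler_norml; lra.
have h3 : vol E <= 12 * J / kappa * T * r.
  have : vol E * kappa <= 12 * J * T * r by nra.
  rewrite -ler_pdivlMr// => /le_trans; apply.
  by rewrite le_eqVlt; apply/orP; left; apply/eqP; ring.
have h4 : vol E ^+ n <= (12 * J / kappa * T * r) ^+ n.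
  by apply: lerXn2r => //; rewrite nnegrE ?(ltW E0)// (le_trans (ltW E0)).
have vE : vol E ^+ n = vol E ^+ n.-1 * vol E by rewrite -exprSr prednK.
move: h4; rewrite [leRHS]exprMn rE vE.
by rewrite ler_pM2r.
Qed.

(** Let m be the unknown density of the common box. Transport from [E1] bounds a/2 * (kappa - m) and
    transport from [E2] bounds a/2 * m; in the sum m cancels. *)
Lemma poincare : exists2 C : R, 0 < C & forall w E1 E2 o L (a : R),
  mu.-integrable setT (EFin \o w) -> (total_variation w setT < +oo)%E ->
  0 < L -> open E1 -> open E2 -> E1 `<=` hbox o L -> E2 `<=` hbox o L ->
  0 < a -> a <= vol E1 -> a <= vol E2 ->
  ae_eq mu E1 w (cst 1) -> ae_eq mu E2 w (cst 0) ->
  a <= C * L * tvr w (obox o L).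
Proof.
have [cb cb1 hcb] := @bump_bounded R.
have [kappa kappa0 hkappa] := @integral_bbox_ge R n.
pose J := jump_const (n := n) cb.
have J0 : 0 < J by exact: jump_const_gt0.
exists (4 * J / kappa); first by rewrite divr_gt0// mulr_gt0.
move=> w E1 E2 o L a iw fw L0 oE1 oE2 EL1 EL2 a0 aE1 aE2 w1 w2.
set T := tvr w (obox o L).
have T0 : 0 <= T by exact: tvr_ge0.
have main E s kap : open E -> E `<=` hbox o L -> a <= vol E -> `|s| = 1 ->
    (forall o l, 0 < l -> hbox o l `<=` E -> kap <= s * density w o l) ->
    a / 2 * (kap - s * density w o L) <= J * L * T.
  move=> oE EL aE s1 dE.
  have E0 : 0 < vol E by exact: lt_le_trans aE.
  have half : a / 2 < vol E by lra.
  have [k hk] := fill_exhaust L0 oE EL half.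
  have fle k' o' l : 0 < l -> vol (fill E k' o' l) <= vol E.
    by move=> l0; exact: vol_fill_le l0 L0 oE EL.
  have h := fill_transport iw fw cb1 hcb n_gt0 E0 s1 dE fle k o L0.
  (* The filled volume may be replaced by its lower bound a / 2 only when the factor is positive;
     otherwise the claim is trivial. *)
  have [neg|pos] := leP (kap - s * density w o L) 0.
    apply: (@le_trans _ _ 0); first by rewrite mulr_ge0_le0//; lra.
    by apply: mulr_ge0 => //; apply: mulr_ge0; exact: ltW.
  apply: (@le_trans _ _ (vol (fill E k o L) * (kap - s * density w o L))).
    by rewrite ler_pM2r// ltW.
  apply: le_trans h _; rewrite ler_wpM2r// -/J ler_wpM2l ?(ltW J0)//.
  exact: cost_le.
have m1 : a / 2 * (kappa - 1 * density w o L) <= J * L * T.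
  apply: (main E1) => //; first by rewrite normr1.
  move=> o' l l0 hE; rewrite mul1r (density_eq_integral iw l0 hE w1) mul1r.
  exact: hkappa.
have m2 : a / 2 * (0 - (- 1) * density w o L) <= J * L * T.
  apply: (main E2) => //; first by rewrite normrN1.
  by move=> o' l l0 hE; rewrite (density_eq_integral iw l0 hE w2) mul0r mulr0.
have : a * kappa <= 4 * J * L * T by nra.
rewrite -ler_pdivlMr// => /le_trans; apply.
by rewrite le_eqVlt; apply/orP; left; apply/eqP; ring.
Qed.

End functional_inequalities.

(** * Translations and difference quotients *)

Section translation.
Context {R : realType}.

Lemma lebesgue_measure_translate (c : R) (A : set (measurableTypeR R)) :
  measurable A ->
  lebesgue_measure ((fun x : measurableTypeR R => (x + c : measurableTypeR R)) @^-1` A) =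
  lebesgue_measure A.
Proof.
move=> mA.
have mphi : measurable_fun setT (fun x : measurableTypeR R => (x + c : measurableTypeR R)).
  by apply: measurable_funD => //; exact: measurable_id.
rewrite -[LHS]/(pushforward lebesgue_measure
  (fun x : measurableTypeR R => (x + c : measurableTypeR R)) A).
symmetry; apply: lebesgue_measure_unique => // X /ocitvP[->|[[a b] /= ab ->]].
  by rewrite !measure0.
rewrite /pushforward.
have -> : (fun x : R => x + c) @^-1` `]a, b] = `]a - c, b - c]%classic.
  by apply/seteqP; split => x; rewrite /= !in_itv /= => h; lra.
rewrite !lebesgue_measure_itv /= !lte_fin ltrD2r.
by case: ifP => // _; rewrite -!EFinB; congr EFin; ring.
Qed.

Lemma measurable_translate n (c : 'rV[R]_n) :
  measurable_fun setT (fun x : 'rV[R]_n => x + c).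
Proof.
apply: measurable_fun_rV => i; under eq_fun do rewrite mxE.
by apply: measurable_funD => //; exact: measurable_coor.
Qed.

Lemma ge0_integral_translate1 (c : R) (f : measurableTypeR R -> \bar R) :
  measurable_fun setT f -> (forall x, (0 <= f x)%E) ->
  (\int[lebesgue_measure]_x f (x + c)%R = \int[lebesgue_measure]_x f x)%E.
Proof.
move=> mf f0.
have mphi : measurable_fun setT (fun x : measurableTypeR R => (x + c : measurableTypeR R)).
  by apply: measurable_funD => //; exact: measurable_id.
have := @ge0_integral_pushforward _ _ _ _ R _ mphi lebesgue_measure setT f
  measurableT mf (fun y _ => f0 y).
rewrite preimage_setT => <-.
apply: eq_measure_integral => A mA _.
exact: lebesgue_measure_translate.
Qed.

(** The measure is an iterated product, so the first coordinate is translated in the outer integral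
    and the others, by induction, in the sections. *)
Lemma lebesgue_rV_translate n (c : 'rV[R]_n) (A : set 'rV[R]_n) :
  measurable A ->
  lebesgue_rV n ((fun x => x + c) @^-1` A) = lebesgue_rV n A.
Proof.
elim: n c A => [|n IH] c A mA.
  congr (lebesgue_rV 0 _); apply/seteqP; split => x /=.
    by have -> : x + c = x by apply/rowP => -[].
  by have -> : x + c = x by apply/rowP => -[].
rewrite /= /cons_measure /pushforward.
set Y := @rV_cons R n @^-1` A.
have mY : measurable Y.
  by rewrite -[Y]setTI; exact: (@measurable_rV_cons R n measurableT).
pose c' : 'rV[R]_n := \row_i c ord0 (lift ord0 i).
rewrite /product_measure1 /=.
transitivity (\int[@lebesgue_measure R]_x
    (fun a => lebesgue_rV n (xsection Y a)) (x + c ord0 ord0)%R)%E; last first.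
  apply: ge0_integral_translate1 => //.
  exact: measurable_fun_xsection.
apply: eq_integral => a _ /=.
rewrite -(IH c' (xsection Y (a + c ord0 ord0))); last exact: measurable_xsection.
congr (lebesgue_rV n _); apply/seteqP; split => y /=.
  rewrite /xsection /= !inE /Y /=.
  rewrite (_ : rV_cons (a, y) + c = rV_cons (a + c ord0 ord0, y + c'))//.
  apply/rowP => i; have [j ->|->] := unliftP ord0 i.
    by rewrite mxE !rV_consS !mxE.
  by rewrite mxE !rV_cons0.
rewrite /xsection /= !inE /Y /=.
rewrite (_ : rV_cons (a, y) + c = rV_cons (a + c ord0 ord0, y + c'))//.
apply/rowP => i; have [j ->|->] := unliftP ord0 i.
  by rewrite mxE !rV_consS !mxE.
by rewrite mxE !rV_cons0.
Qed.

Section integral_translate.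
Context {n : nat}.
Let mu := @lebesgue_rV R n.

Lemma ge0_integral_translate (c : 'rV[R]_n) (f : 'rV[R]_n -> \bar R) :
  measurable_fun setT f -> (forall x, (0 <= f x)%E) ->
  (\int[mu]_x f (x + c)%R = \int[mu]_x f x)%E.
Proof.
move=> mf f0.
have := @ge0_integral_pushforward _ _ _ _ R _ (measurable_translate c) mu setT f
  measurableT mf (fun y _ => f0 y).
rewrite preimage_setT => <-.
have mt := measurable_translate c; apply: eq_measure_integral => A mA _.
exact: lebesgue_rV_translate.
Qed.

Lemma integrable_translate (c : 'rV[R]_n) (f : 'rV[R]_n -> R) :
  mu.-integrable setT (EFin \o f) ->
  mu.-integrable setT (EFin \o (fun x => f (x + c))).
Proof.
move=> /integrableP[mf fi]; apply/integrableP; split.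
  exact: (measurableT_comp mf (measurable_translate c)).
have := @ge0_integral_translate c (fun x => `|(f x)%:E|%E).
move=> -> //; exact: measurableT_comp.
Qed.

Lemma Rintegral_translate (c : 'rV[R]_n) (f : 'rV[R]_n -> R) :
  mu.-integrable setT (EFin \o f) ->
  (\int[mu]_x f (x + c))%R = (\int[mu]_x f x)%R.
Proof.
move=> fi; have /integrableP[mf _] := fi.
rewrite /Rintegral; congr fine.
have h := @integral_pushforward _ _ _ _ R _ (measurable_translate c) mu setT
  (EFin \o f) mf (integrable_translate c fi) measurableT.
transitivity (\int[pushforward mu (fun x => (x + c)%R)]_y (EFin \o f) y)%E.
  exact/esym/h.
have mt := measurable_translate c; apply: eq_measure_integral => A mA _.
exact: lebesgue_rV_translate.
Qed.

End integral_translate.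
End translation.

Section difference_quotient.
Context {R : realType} {n : nat}.
Let mu := @lebesgue_rV R n.
Implicit Types (f u : 'rV[R]_n -> R) (x : 'rV[R]_n).
Variable i : 'I_n.
Let e : 'rV[R]_n := delta_mx ord0 i.

Lemma is_derive_line f x (t : R) : smooth f ->
  is_derive t (1 : R) (fun t => f (t *: e + x)) (partial i f (t *: e + x)).
Proof.
move=> sf; have df := @smooth_derivable _ _ f (t *: e + x) i sf.
have lim : h^-1 *: (((fun t => f (t *: e + x)) \o shift t) (h *: (1 : R)) -
    f (t *: e + x)) @[h --> (0 : R)^'] --> partial i f (t *: e + x).
  have -> : (fun h => h^-1 *: (((fun t => f (t *: e + x)) \o shift t) (h *: (1 : R)) -
      f (t *: e + x))) =
    (fun h => h^-1 *: ((f \o shift (t *: e + x)) (h *: e) - f (t *: e + x))).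
    apply/funext => h /=; rewrite (_ : h *: (1 : R) = h); last exact: mulr1.
    by rewrite scalerDl addrA.
  exact: df.
by apply: DeriveDef; [apply/cvg_ex; eexists; exact: lim|exact: cvg_lim lim].
Qed.

Lemma difference_quotient_le f (c h : R) x : smooth f ->
  (forall y, `|partial i f y| <= c) -> 0 < h ->
  `|h^-1 * (f (h *: e + x) - f x)| <= c.
Proof.
move=> sf fc h0.
have [||a _ hE] := @MVT R (fun t => f (t *: e + x))
  (fun t => partial i f (t *: e + x)) 0 h h0.
- by move=> t _; exact: is_derive_line.
- apply: continuous_subspaceT; apply: derivable_continuous1 => t.
  by have [] := is_derive_line x t sf.
- move: hE; rewrite scale0r add0r subr0 => ->.
  by rewrite mulrCA mulVf ?mulr1// gt_eqF.
Qed.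

Lemma difference_quotient_cvg f x : smooth f ->
  (k.+1%:R * (f (k.+1%:R^-1 *: e + x) - f x)) @[k --> \oo] --> partial i f x.
Proof.
move=> sf.
have df : h^-1 *: ((f \o shift x) (h *: e) - f x) @[h --> (0 : R)^'] -->
    partial i f x by exact: (@smooth_derivable _ _ f x i sf).
have ck : k.+1%:R^-1 @[k --> \oo] --> (0 : R)^'.
  have c0 : k.+1%:R^-1 @[k --> \oo] --> (0 : R) by exact: cvg_harmonic.
  move=> A A0; have h : \forall k \near \oo, (k.+1%:R^-1 != 0 :> R) -> A k.+1%:R^-1.
    exact: c0 A0.
  by apply: filterS h => k; apply; rewrite invr_eq0 pnatr_eq0.
have := cvg_comp _ _ ck df.
apply: cvg_trans; apply: near_eq_cvg; near=> k.
by rewrite /= invrK.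
Unshelve. all: by end_near. Qed.

(** Discrete integration by parts: translation invariance moves the difference quotient from the
    smooth [f] to [u], for which no regularity is assumed. The quotients of [f] are bounded by the
    mean value theorem, so dominated convergence yields the derivative. *)
Lemma pairing_partial_le f u (K : set 'rV[R]_n) (c : R) :
  smooth f -> compact K -> (forall x, ~ K x -> f x = 0) ->
  (forall x, ~ K x -> partial i f x = 0) ->
  mu.-integrable setT (EFin \o u) ->
  (\forall h \near (0 : R)^'+,
     (\int[mu]_x (f x * (u (x - h *: e) - u x)))%R <= h * c) ->
  pairing u (partial i f) <= c.
Proof.
move=> sf cK fK pK iu hc.
have [c1 c10 fc1] := compact_support_bounded cK (smooth_continuous sf) fK.
have [c2 c20 fc2] := compact_support_bounded cK
  (smooth_continuous (smooth_partial i sf)) pK.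
have mf : measurable_fun setT f.
  by apply: continuous_measurable_rV; exact: smooth_continuous.
pose q k x := k.+1%:R * (f (k.+1%:R^-1 *: e + x) - f x).
have mq k : measurable_fun setT (q k).
  apply: measurable_funM => //; apply: measurable_funB => //.
  rewrite (_ : (fun x => _) = f \o (fun x => x + k.+1%:R^-1 *: e)); last first.
    by apply/funext => x /=; rewrite addrC.
  exact: (measurableT_comp mf (measurable_translate _)).
have qc k x : `|q k x| <= c2.
  have k0 : 0 < k.+1%:R^-1 :> R by rewrite invr_gt0.
  by have := difference_quotient_le x sf fc2 k0; rewrite invrK.
have iq k : pairable u (q k) := integrable_mul_bounded iu (mq k) (qc k).
have pq k : pairing u (q k) =
    k.+1%:R * (\int[mu]_x (f x * (u (x - k.+1%:R^-1 *: e) - u x)))%R.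
  set d := k.+1%:R^-1 *: e.
  have i1 : pairable u f := integrable_mul_bounded iu mf fc1.
  have iut := integrable_translate (- d) iu.
  have i2 : pairable (fun x => u (x - d)) f := integrable_mul_bounded iut mf fc1.
  have i3 := integrable_translate d i2.
  transitivity (\int[mu]_x (k.+1%:R *
      (u (x + d - d) * f (x + d) - u x * f x)))%R.
    apply: eq_Rintegral => x _; rewrite addrK /q [d + x]addrC -/d.
    by rewrite mulrCA mulrBr.
  rewrite RintegralZl//; last first.
    have := @integrableB _ _ _ mu setT measurableT _ _ i3 i1.
    by congr (is_true (integrable _ _ _)); apply/funext => x.
  congr (_ * _); rewrite RintegralB//.
  rewrite (Rintegral_translate d i2) -RintegralB//.
  by apply: eq_Rintegral => x _; rewrite mulrBr mulrC [f x * u x]mulrC.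
have ip : pairable u (partial i f).
  apply: (integrable_mul_bounded iu _ fc2).
  apply: continuous_measurable_rV; apply: smooth_continuous.
  exact: smooth_partial.
have lim : pairing u (q k) @[k --> \oo] --> pairing u (partial i f).
  have [] := @dominated_convergence _ _ _ mu setT measurableT
    (fun k x => (u x * q k x)%:E) (fun x => (u x * partial i f x)%:E)
    (fun x => (c2 * `|u x|)%:E).
  - by move=> k; exact: measurable_int (iq k).
  - exact: measurable_int ip.
  - apply: aeW => x _; apply/cvg_EFin; first by near=> k.
    apply: cvgM; first exact: cvg_cst.
    exact: difference_quotient_cvg.
  - exact: (@integrableZl _ _ _ mu setT measurableT c2 _ (integrable_norm iu)).
  - apply: aeW => x k _ /=; rewrite lee_fin normrM mulrC.
    by rewrite ler_wpM2r.
  move=> _ _.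
  rewrite (_ : (\int[mu]_x _)%E = (pairing u (partial i f))%:E).
    exact: fine_cvg.
  by rewrite /pairing /Rintegral fineK//; exact: (integrable_fin_num measurableT ip).
apply: (cvgr_to_le lim).
have c0 : k.+1%:R^-1 @[k --> \oo] --> (0 : R) by exact: cvg_harmonic.
have h : \forall k \near \oo, (0 < k.+1%:R^-1 :> R) ->
    (\int[mu]_x (f x * (u (x - k.+1%:R^-1 *: e) - u x)))%R <= k.+1%:R^-1 * c.
  exact: c0 hc.
apply: filterS h => k /(_ _)/wrap[]; first by rewrite invr_gt0.
by rewrite pq => h; rewrite -ler_pdivlMl.
Unshelve. all: by end_near. Qed.

End difference_quotient.

(** * Cut-offs of indicator functions of components *)

Section segments.
Context {R : realType} {n : nat}.
Implicit Types (x y z p : 'rV[R]_n) (A Om : set 'rV[R]_n) (r s t : R).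

Lemma ballE x r y : ball x r y <-> `|x - y| < r.
Proof. by rewrite mx_norm_ball. Qed.

Lemma connected_component_segment A p y y' : connected_component A p y ->
  (forall t, 0 <= t <= 1 -> A (y + t *: (y' - y))) ->
  connected_component A p y'.
Proof.
move=> py seg; apply: (connected_component_trans py).
exists ((fun t : R => y + t *: (y' - y)) @` `[0, 1]%classic).
  split.
  - by exists 0; rewrite ?scale0r ?addr0//= in_itv /= lexx ler01.
  - by move=> _ [t /= + <-]; rewrite in_itv /=; exact: seg.
  - apply: connected_continuous_connected; first exact: segment_connected.
    apply: continuous_subspaceT => t.
    by apply: cvgD; [exact: cvg_cst|apply: cvgZr_tmp; exact: cvg_id].
exists 1; last by rewrite scale1r addrC subrK.
by rewrite /= in_itv /= lexx ler01.
Qed.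

Lemma norm_segment y y' t : 0 <= t <= 1 ->
  `|y - (y + t *: (y' - y))| <= `|y - y'|.
Proof.
move=> /andP[t0 t1].
rewrite opprD addrA subrr add0r normrN normrZ ger0_norm//.
by rewrite distrC -[leRHS]mul1r ler_wpM2r.
Qed.

(** Balls are convex, so a point near y is joined to y by a segment inside [A]. *)
Lemma open_connected_component A p : open A -> open (connected_component A p).
Proof.
move=> oA; rewrite openE => y py.
have Ay := connected_component_sub py.
have /nbhs_ballP[r /= r0 yA] := open_nbhs_nbhs (conj oA Ay).
apply/nbhs_ballP; exists r => //= y' /ballE yy'.
apply: (connected_component_segment py) => t t01.
by apply: yA; apply/ballE; exact: le_lt_trans (norm_segment _ _ t01) yy'.
Qed.

End segments.

Section cutoff.
Context {R : realType} {n : nat}.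
Let mu := @lebesgue_rV R n.
Implicit Types (x y z p : 'rV[R]_n) (Om D : set 'rV[R]_n) (r s t : R).

Definition tent x s t y : R := Num.min 1 (Num.max 0 ((s - `|x - y|) / (s - t))).

Lemma tent_ge0 x s t y : 0 <= tent x s t y.
Proof. by rewrite le_min ler01 le_max lexx. Qed.

Lemma tent_le1 x s t y : tent x s t y <= 1.
Proof. by rewrite ge_min lexx. Qed.

Lemma tent_eq1 x s t y : t < s -> `|x - y| <= t -> tent x s t y = 1.
Proof.
move=> ts xy; apply/min_idPl; rewrite le_max; apply/orP; right.
by rewrite ler_pdivlMr ?subr_gt0// mul1r lerD2l lerN2.
Qed.

Lemma tent_eq0 x s t y : t < s -> s <= `|x - y| -> tent x s t y = 0.
Proof.
move=> ts xy; rewrite /tent (max_idPl _) ?min_r//.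
by rewrite pmulr_lle0 ?invr_gt0 ?subr_gt0// subr_le0.
Qed.

Lemma clamp_lip (a b : R) :
  `|Num.min 1 (Num.max 0 a) - Num.min 1 (Num.max 0 b)| <= `|a - b|.
Proof.
have min_lip (c d : R) : `|Num.min 1 c - Num.min 1 d| <= `|c - d|.
  have := ler_norm (c - d); have := ler_norm (d - c); rewrite distrC => h1 h2.
  by rewrite ler_norml; case: (leP 1 c) => ?; case: (leP 1 d) => ?; apply/andP; split; lra.
have max_lip (c d : R) : `|Num.max 0 c - Num.max 0 d| <= `|c - d|.
  have := ler_norm (c - d); have := ler_norm (d - c); rewrite distrC => h1 h2.
  by rewrite ler_norml; case: (leP 0 c) => ?; case: (leP 0 d) => ?; apply/andP; split; lra.
exact: le_trans (min_lip _ _) (max_lip _ _).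
Qed.

Lemma tent_lip x s t y y' : t < s ->
  `|tent x s t y - tent x s t y'| <= `|y - y'| / (s - t).
Proof.
move=> ts; apply: le_trans (clamp_lip _ _) _.
have st0 : 0 < s - t by rewrite subr_gt0.
rewrite -mulrBl normrM [X in _ * X]gtr0_norm ?invr_gt0//.
rewrite ler_wpM2r ?invr_ge0 ?(ltW st0)//.
have -> : s - `|x - y| - (s - `|x - y'|) = `|x - y'| - `|x - y| by ring.
apply: le_trans (ler_dist_dist _ _) _.
by rewrite opprB addrC addrA subrK.
Qed.

Lemma continuous_tent x s t : t < s -> continuous (tent x s t).
Proof.
move=> ts y A /nbhs_ballP[e /= e0 eA]; apply/nbhs_ballP.
exists (e * (s - t)) => /=; first by rewrite mulr_gt0// subr_gt0.
move=> y' /ballE yy'; apply: eA; apply: le_lt_trans (tent_lip _ _ _ ts) _.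
by rewrite ltr_pdivrMr ?subr_gt0.
Qed.

Definition cutoff D x s t y : R := \1_D y * tent x s t y.

Lemma cutoff_in D x s t y : D y -> cutoff D x s t y = tent x s t y.
Proof. by move=> Dy; rewrite /cutoff indicE mem_set// mul1r. Qed.

Lemma cutoff_out D x s t y : ~ D y -> cutoff D x s t y = 0.
Proof. by move=> Dy; rewrite /cutoff indicE memNset// mul0r. Qed.

Lemma cutoff_support D x s t y : t < s -> ~ (D `&` ball x s) y ->
  cutoff D x s t y = 0.
Proof.
move=> ts h; have [Dy|/cutoff_out//] := pselect (D y).
rewrite cutoff_in// tent_eq0// leNgt; apply/negP => /ballE ?; exact: h.
Qed.

Lemma ball_sub_hbox x s : ball x s `<=` hbox (x - const_mx s) (2 * s).
Proof.
move=> y [s0 xy] i; rewrite !mxE.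
have := xy ord0 i; rewrite /ball /= ltr_norml => h; lra.
Qed.

Lemma ball_eq_obox x s : 0 < s -> ball x s = obox (x - const_mx s) (2 * s).
Proof.
move=> s0; apply/seteqP; split=> y.
  move=> [_ xy] i; rewrite !mxE.
  by have := xy ord0 i; rewrite /ball /= ltr_norml => h; lra.
move=> h; split=> // j i; rewrite [j]ord1.
by have := h i; rewrite !mxE /ball /= ltr_norml => {}h; lra.
Qed.

Lemma vol_ball_fin D x s : 0 < s -> open D -> mu (D `&` ball x s) \is a fin_num.
Proof.
move=> s0 oD; apply: (@vol_fin _ _ _ (x - const_mx s) (2 * s)).
- by rewrite mulr_ge0// ltW.
- by apply: open_measurable_rV; apply: openI => //; exact: ball_open.
- by move=> y [_ /ball_sub_hbox].
Qed.

Section bound.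
Variables (Om : set 'rV[R]_n) (z p x : 'rV[R]_n) (rho s t : R).
Hypotheses (oOm : open Om) (t0 : 0 < t) (ts : t < s).
Hypothesis xrho : `|x - z| + s < rho.
Let D := connected_component (Om `&` ball z rho) p.
Let S := D `&` ball x s.
Let u := cutoff D x s t.
Let s0 : 0 < s := lt_trans t0 ts.
Let st0 : 0 < s - t. Proof. by rewrite subr_gt0. Qed.

Let oD : open D.
Proof. by apply: open_connected_component; apply: openI => //; exact: ball_open. Qed.

Let oS : open S. Proof. by apply: openI => //; exact: ball_open. Qed.

Let mS : measurable S. Proof. exact: open_measurable_rV. Qed.

Let fS : mu S \is a fin_num. Proof. exact: vol_ball_fin. Qed.

Let u_ge0 y : 0 <= u y.
Proof. by rewrite mulr_ge0// tent_ge0. Qed.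

Let u_le_indic y : u y <= \1_S y.
Proof.
rewrite indicE; have [Sy|nSy] := pselect (S y).
  by rewrite mem_set//= -[leRHS]mul1r ler_pM// ?tent_ge0// ?tent_le1// indicE lern1 leq_b1.
by rewrite memNset//= [u y]cutoff_support.
Qed.

Let mu_u : measurable_fun setT u.
Proof.
apply: measurable_funM; first by apply: measurable_indic; exact: open_measurable_rV.
by apply: continuous_measurable_rV; exact: continuous_tent.
Qed.

Let indic_integrable : mu.-integrable setT (EFin \o \1_S).
Proof.
apply/integrableP; split; first exact/measurable_EFinP/measurable_indic.
under eq_integral do rewrite /= ger0_norm//.
rewrite integral_indic// setIT.
by have : (mu S < +oo)%E by rewrite ltey_eq fS.
Qed.

Let indic_integral : (\int[mu]_y \1_S y)%R = vol S.
Proof. by rewrite /Rintegral integral_indic// setIT. Qed.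

Lemma integrable_cutoff : mu.-integrable setT (EFin \o u).
Proof.
apply: le_integrable indic_integrable => //; first exact/measurable_EFinP.
by move=> y _ /=; rewrite lee_fin ger0_norm// ger0_norm//; exact: u_le_indic.
Qed.

(* A path that stays in [Om] and near [ball x s] does not leave the component [D]. *)
Let cutoff_lip (h : R) y y' : 0 <= h -> `|x - z| + s + h < rho ->
  `|y - y'| <= h -> (forall q, `|y - q| <= h -> Om q) -> S y \/ S y' ->
  `|u y' - u y| <= h / (s - t).
Proof.
move=> h0 hrho yy' yOm SS.
have y'y : `|y' - y| <= h by rewrite distrC.
have tl a : 0 <= a <= 1 -> `|y - (y + a *: (y' - y))| <= h.
  by move=> a01; exact: le_trans (norm_segment _ _ a01) yy'.
have zq q v : `|x - v| < s -> `|v - q| <= h -> `|z - q| < rho.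
  move=> xv vq; apply: le_lt_trans hrho.
  have -> : z - q = (z - x) + ((x - v) + (v - q)) by rewrite !addrA !subrK.
  have xz : `|z - x| = `|x - z| by rewrite distrC.
  apply: le_trans (ler_normD _ _) _; rewrite xz -[leRHS]addrA lerD2l.
  by apply: le_trans (ler_normD _ _) _; apply: lerD => //; exact: ltW.
have [Dy Dy'] : D y /\ D y'.
  case: SS => -[Dv /ballE xv].
    split=> //; apply: (connected_component_segment Dv) => a a01.
    have ya := tl a a01.
    by split; [exact: yOm|apply/ballE; exact: zq ya].
  split=> //; apply: (connected_component_segment Dv) => a a01.
  have ya : `|y' - (y' + a *: (y - y'))| <= h.
    by exact: le_trans (norm_segment _ _ a01) y'y.
  split; last by apply/ballE; exact: zq ya.
  (* [yOm] is centred at y while this segment starts from y', so its points have to be measured from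
     y. *)
  apply: yOm; move/andP: a01 => [a0 a1].
  have -> : y - (y' + a *: (y - y')) = (1 - a) *: (y - y').
    by rewrite scalerBl scale1r opprD addrA.
  rewrite normrZ ger0_norm ?subr_ge0//; apply: le_trans yy'.
  by rewrite -[leRHS]mul1r ler_wpM2r// lerBlDr lerDl.
rewrite /u !cutoff_in//; apply: le_trans (tent_lip _ _ _ ts) _.
by rewrite ler_wpM2r// invr_ge0 ltW.
Qed.

(** On the support of [v], a small shift h changes [u] by at most h / (s - t), and only at points of
    [S] or of its translate; the factor 2 counts these two sets of equal volume. *)
Lemma pairing_cutoff_le v i : test_field Om v ->
  (forall y, enorm (v y) <= 1) ->
  pairing u (partial i (fun y => v y ord0 i)) <= 2 * vol S / (s - t).
Proof.
move=> tv v1; have [sv cv vOm] := tv.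
pose K := closure [set y | v y != 0].
have tK : test_field K v by split.
have v0 y : ~ K y -> v y ord0 i = 0.
  by move=> Ky; rewrite (test_field_eq0 tK Ky) mxE.
apply: (pairing_partial_le (sv i) cv v0) => //.
- by move=> y Ky; exact: partial_eq0 tK Ky.
- exact: integrable_cutoff.
(* Compactness of the support turns the pointwise distance to the complement of [Om] into a uniform
   one, so that short segments from [K] stay in [Om]. *)
have near_Om : \forall h \near (0 : R)^'+, K `<=` [set y | forall q, `|y - q| <= h -> Om q].
  move/compact_near_coveringP : cv; apply => y /vOm Oy.
  have /nbhs_ballP[r /= r0 yr] := open_nbhs_nbhs (conj oOm Oy).
  have r20 : 0 < r / 2 by rewrite divr_gt0.
  exists (ball y (r / 2), [set h : R | h < r / 2]).
    split; first exact: nbhsx_ballx.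
    exact: nbhs_right_lt.
  move=> [y' h] /= [/ballE yy' hr] q y'q; apply: yr; apply/ballE.
  have -> : y - q = (y - y') + (y' - q) by rewrite addrA subrK.
  by apply: le_lt_trans (ler_normD _ _) _; rewrite (splitr r) ltrD// (le_lt_trans y'q).
near=> h.
have h0 : 0 < h by near: h; exact: nbhs_right_gt.
have hrho : `|x - z| + s + h < rho.
  rewrite -ltrBrDl; near: h; apply: nbhs_right_lt.
  by rewrite subr_gt0.
have hOm : K `<=` [set y | forall q, `|y - q| <= h -> Om q] by near: h.
set e : 'rV[R]_n := delta_mx ord0 i.
have he : `|h *: e| <= h.
  rewrite normrZ gtr0_norm// -[leRHS]mulr1 ler_wpM2l ?(ltW h0)//.
  rewrite /Num.norm /= mx_normrE; apply: bigmax_le => // -[a b] _ /=.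
  by rewrite mxE; case: (_ && _); rewrite ?normr1 ?normr0.
pose c := h / (s - t).
have c0 : 0 <= c by rewrite divr_ge0// ltW.
have it := integrable_translate (- (h *: e)) indic_integrable.
have iut := integrable_translate (- (h *: e)) integrable_cutoff.
have ib : mu.-integrable setT (EFin \o (fun y => c * (\1_S y + \1_S (y - h *: e)))).
  have := @integrableZl _ _ _ mu setT measurableT c _
    (@integrableD _ _ _ mu setT measurableT _ _ indic_integrable it).
  by congr (is_true (integrable _ _ _)); apply/funext => y.
have id : mu.-integrable setT (EFin \o (fun y => u (y - h *: e) - u y)).
  have := @integrableB _ _ _ mu setT measurableT _ _ iut integrable_cutoff.
  by congr (is_true (integrable _ _ _)); apply/funext => y.
have mv : measurable_fun setT (fun y => v y ord0 i).
  by apply: continuous_measurable_rV; exact/smooth_continuous.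
have bv y : `|v y ord0 i| <= 1 by apply: le_trans (ler_enorm _ _) (v1 y).
have il : mu.-integrable setT (EFin \o (fun y => v y ord0 i * (u (y - h *: e) - u y))).
  have := integrable_mul_bounded id mv bv.
  by congr (is_true (integrable _ _ _)); apply/funext => y /=; rewrite mulrC.
apply: (@le_trans _ _ (\int[mu]_y (c * (\1_S y + \1_S (y - h *: e))))%R); last first.
  rewrite RintegralZl//; last first.
    have := @integrableD _ _ _ mu setT measurableT _ _ indic_integrable it.
    by congr (is_true (integrable _ _ _)); apply/funext => y.
  rewrite RintegralD//.
  rewrite (Rintegral_translate (- (h *: e)) indic_integrable) indic_integral.
  by rewrite le_eqVlt; apply/orP; left; apply/eqP; rewrite /c; ring.
apply: le_Rintegral => // y _.
have [Ky|Ky] := pselect (K y); last first.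
  by rewrite v0// mul0r mulr_ge0// addr_ge0.
apply: le_trans (ler_norm _) _; rewrite normrM -[leRHS]mul1r ler_pM//.
have [SS|nSS] := pselect (S y \/ S (y - h *: e)).
  have h1 : `|u (y - h *: e) - u y| <= c.
    have yy : `|y - (y - h *: e)| <= h by rewrite opprB addrC subrK.
    exact: (@cutoff_lip h y (y - h *: e) (ltW h0) hrho yy (hOm y Ky) SS).
  apply: le_trans h1 _; rewrite -[leLHS]mulr1 ler_wpM2l//.
  rewrite !indicE; case: SS => SS; rewrite (mem_set SS) /=; first by rewrite lerDl.
  by rewrite lerDr.
have [nS1 nS2] : ~ S y /\ ~ S (y - h *: e) by split=> ?; apply: nSS; [left|right].
by rewrite /u !cutoff_support// subrr normr0 mulr_ge0// addr_ge0.
Unshelve. all: by end_near. Qed.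

Lemma total_variation_cutoff :
  (total_variation u Om <= (n%:R * (2 * vol S / (s - t)))%:E)%E.
Proof.
apply: ge_ereal_sup => _ [v [tv v1] <-].
have [sv cv vOm] := tv.
rewrite (pairing_test integrable_cutoff tv) lee_fin.
rewrite /divergence pairing_sum; last first.
  move=> i; have [c _ hc] := compact_support_bounded cv
    (smooth_continuous (smooth_partial i (sv i)))
    (fun y => @partial_eq0 _ _ (closure [set y | v y != 0]) v y i (And3 sv cv (@subset_refl _ _))).
  apply: (integrable_mul_bounded integrable_cutoff _ hc).
  by apply: continuous_measurable_rV; apply: smooth_continuous; exact: smooth_partial.
apply: (@le_trans _ _ (\sum_(i < n) 2 * vol S / (s - t))).
  by apply: ler_sum => i _; exact: pairing_cutoff_le.
by rewrite sumr_const card_ord -[X in X <= _]mulr_natl.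
Qed.

Lemma BV_cutoff : BV Om u.
Proof.
split; last by apply: le_lt_trans total_variation_cutoff (ltry _).
apply: integrableS integrable_cutoff => //; exact: open_measurable_rV.
Qed.

Lemma BV_norm_cutoff :
  (BV_norm Om u <= (vol S + n%:R * (2 * vol S / (s - t)))%:E)%E.
Proof.
rewrite EFinD; apply: leeD; last exact: total_variation_cutoff.
have mOm := open_measurable_rV oOm.
have -> : (vol S)%:E = (\int[mu]_y (\1_S y)%:E)%E.
  by rewrite integral_indic// setIT /vol fineK.
apply: (@le_trans _ _ (\int[mu]_(y in Om) (\1_S y)%:E)%E).
  apply: ge0_le_integral => //.
  - apply/measurable_EFinP; apply: measurableT_comp => //.
    exact: measurable_funTS.
  - apply/measurable_EFinP; exact: measurable_funTS.
  - by move=> y _; rewrite lee_fin ger0_norm//; exact: u_le_indic.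
apply: ge0_subset_integral => //.
exact/measurable_EFinP/measurable_indic.
Qed.

End bound.
End cutoff.

(** * Volume density and packing *)

Section iteration.
Context {R : realType}.

(* De Giorgi iteration on the radii [s / 2 * (1 + 2 ^ - j)]. *)
Lemma volume_growth (n : nat) (K s : R) (m : R -> R) : (1 < n)%N ->
  0 < K -> 0 < s -> (forall t, 0 < t -> t <= s -> 0 < m t) ->
  (forall t t', 0 < t -> t <= t' -> t' <= s -> m t <= m t') ->
  (forall t t', 0 < t -> t < t' -> t' <= s ->
     m t ^+ n.-1 <= (K * m t' / (t' - t)) ^+ n) ->
  (2 ^- n) ^+ n.-1 / (4 * K) ^+ n * s ^+ n <= m s.
Proof.
move=> n1 K0 s0 m0 mle mK.
(* [d] is the threshold at which the bound m(r_j) <= d q^j s^n reproduces itself: (4K)^n d = q^(n-1)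
   settles the constants, and 2^n q = 1 absorbs the growth of 1 / (r_j - r_(j+1)). *)
set q : R := 2 ^- n; set d := q ^+ n.-1 / (4 * K) ^+ n.
have q0 : 0 < q by rewrite invr_gt0 exprn_gt0.
have n0 : (0 < n)%N := ltnW n1.
have K40 : 0 < 4 * K by rewrite mulr_gt0.
have d0 : 0 < d by rewrite divr_gt0// exprn_gt0.
have key : (4 * K) ^+ n * d = q ^+ n.-1.
  by rewrite /d mulrC divfK// gt_eqF// exprn_gt0.
have hq : 2 ^+ n * q = 1 by rewrite divff// expf_neq0.
have q1 : `|q| < 1.
  rewrite ger0_norm ?(ltW q0)// invf_lt1 ?exprn_gt0//.
  by rewrite exprn_egt1 ?ltr1n// -lt0n.
rewrite leNgt; apply/negP => ms; clearbody d; clearbody q.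
pose r (j : nat) : R := s / 2 * (1 + 2 ^- j).
have p0 j : 0 < 2 ^- j :> R by rewrite invr_gt0 exprn_gt0.
have r0 j : 0 < r j by rewrite mulr_gt0 ?divr_gt0// addr_gt0.
have rS j : r j - r j.+1 = s * 2 ^- j / 4.
  by rewrite /r exprSr invfM; move: (2 ^- j) => z; field.
have rs j : r j <= s.
  have : 2 ^- j <= 1 :> R by rewrite invf_le1 ?exprn_gt0// exprn_ege1// ler1n.
  by rewrite /r; move: (2 ^- j) => z; nra.
have half j : s / 2 <= r j.
  by rewrite /r; have := p0 j; move: (2 ^- j) => z; nra.
have step j : m (r j) <= d * q ^+ j * s ^+ n.
  elim: j => [|j IH].
    by rewrite /r expr0 invr1 mulr1 (_ : s / 2 * (1 + 1) = s); [exact: ltW|field].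
  have rlt : r j.+1 < r j by rewrite -subr_gt0 rS divr_gt0// mulr_gt0.
  have m1 := mK _ _ (r0 j.+1) rlt (rs j).
  rewrite -(@ler_pXn2r _ n.-1) ?nnegrE//; first last.
  - by rewrite !mulr_ge0 ?exprn_ge0 ?(ltW s0) ?(ltW d0) ?(ltW q0).
  - by rewrite ltW// m0.
  - by rewrite -ltnS prednK.
  apply: le_trans m1 _.
  apply: (@le_trans _ _ ((K * (d * q ^+ j * s ^+ n) / (r j - r j.+1)) ^+ n)).
    apply: lerXn2r; rewrite ?nnegrE.
    - by rewrite !mulr_ge0 ?invr_ge0 ?subr_ge0 ?(ltW rlt) ?(ltW K0)// ltW// m0.
    - by rewrite !mulr_ge0 ?exprn_ge0 ?invr_ge0 ?subr_ge0 ?(ltW rlt) ?(ltW K0)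
        ?(ltW s0) ?(ltW d0) ?(ltW q0).
    - rewrite ler_wpM2r ?invr_ge0 ?subr_ge0 ?(ltW rlt)// ler_wpM2l//.
      exact: ltW.
  rewrite rS.
  have sN : s ^+ n = s ^+ n.-1 * s by rewrite -exprSr prednK.
  have -> : K * (d * q ^+ j * s ^+ n) / (s * 2 ^- j / 4) =
      (4 * K) * d * (2 * q) ^+ j * s ^+ n.-1.
    rewrite sN exprMn; have := p0 j; rewrite invr_gt0 => /gt_eqF pj.
    move: (2 ^+ j) (q ^+ j) (s ^+ n.-1) pj => a b c pj.
    by field; rewrite (gt_eqF s0) pj.
  have dn : d ^+ n = d ^+ n.-1 * d by rewrite -exprSr prednK.
  have q2 : ((2 * q) ^+ j) ^+ n = (q ^+ j) ^+ n.-1.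
    rewrite -!exprM mulnC [in RHS]mulnC !exprM; congr (_ ^+ j).
    have qn : q ^+ n = q * q ^+ n.-1 by rewrite -exprS prednK.
    by rewrite exprMn qn mulrA hq mul1r.
  have e1 (A B S : R) : (A * d * B * S) ^+ n = A ^+ n * d ^+ n * B ^+ n * S ^+ n.
    by rewrite !exprMn.
  have e2 (A S : R) : (d * A * S) ^+ n.-1 = d ^+ n.-1 * A ^+ n.-1 * S ^+ n.-1.
    by rewrite !exprMn.
  rewrite e1 e2 q2 dn exprS [(q * _) ^+ _]exprMn -key [(s ^+ n.-1) ^+ n]exprAC.
  by rewrite le_eqVlt; apply/orP; left; apply/eqP; ring.
have s20 : 0 < s / 2 by rewrite divr_gt0.
have mh : 0 < m (s / 2) by apply: m0 => //; rewrite ler_pdivrMr//; lra.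
(* The radii stay above s / 2, so m(s / 2) lies below a sequence tending to 0, although it is
   positive. *)
have := @cvg_geometric R (d * s ^+ n) q q1.
move=> /cvgrPdist_lt /(_ _ mh)[j _ /(_ j (leqnn j))].
rewrite /= sub0r normrN /geometric /= ltNge => /negP; apply.
rewrite ger0_norm; last first.
  by rewrite !mulr_ge0 ?exprn_ge0 ?(ltW s0) ?(ltW d0) ?(ltW q0).
by rewrite mulrAC (le_trans _ (step j))// mle.
Qed.

End iteration.

Section extension.
Context {R : realType} {n : nat}.
Let mu := @lebesgue_rV R n.
Implicit Types (x y z p : 'rV[R]_n) (Om : set 'rV[R]_n) (rho r s t : R).
Hypothesis n_gt1 : (1 < n)%N.

Definition piece Om z rho p := connected_component (Om `&` ball z rho) p.

Lemma open_piece Om z rho p : open Om -> open (piece Om z rho p).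
Proof.
by move=> oOm; apply: open_connected_component; apply: openI => //; exact: ball_open.
Qed.

(** The extension is bounded in the full [BV] norm, not by the variation alone. For s - t <= 1 the
    integral term is at most vol / (s - t) and joins the variation term, whence the factor 1 +
    2n. *)
Lemma extension_of_cutoff Om : BV_extension_domain Om ->
  exists2 C : R, 0 < C & forall z p x rho s t, 0 < t -> t < s -> s - t <= 1 ->
  `|x - z| + s < rho ->
  exists w, [/\ mu.-integrable setT (EFin \o w),
    (total_variation w setT < +oo)%E,
    tvr w setT <= C * vol (piece Om z rho p `&` ball x s) / (s - t),
    ae_eq mu (piece Om z rho p `&` ball x t) w (cst 1) &
    ae_eq mu (Om `\` piece Om z rho p) w (cst 0)].
Proof.
move=> [[_ oOm _] [C [T [C0 _ CT]]]].
exists (C * (1 + n%:R * 2)); first by rewrite mulr_gt0// ltr_wpDr.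
move=> z p x rho s t t0 ts st1 xrho.
pose D := piece Om z rho p.
have bu := @BV_cutoff R n Om z p x rho s t oOm t0 ts xrho.
have nu := @BV_norm_cutoff R n Om z p x rho s t oOm t0 ts xrho.
have [[iw fw] ae bn] := CT _ bu.
exists (T (cutoff D x s t)); split => //.
- rewrite -lee_fin /tvr fineK; last exact: total_variation_fin.
  have st0 : 0 < s - t by rewrite subr_gt0.
  apply: (@le_trans _ _ (BV_norm setT (T (cutoff D x s t)))).
    by rewrite leeDr//; apply: integral_ge0 => y _; rewrite lee_fin.
  apply: le_trans bn _.
  apply: (le_trans (lee_wpmul2l _ nu)); first by rewrite lee_fin ltW.
  rewrite -EFinM lee_fin.
  set V := vol _; have V0 : 0 <= V by exact: vol_ge0.
  rewrite -!mulrA ler_wpM2l ?(ltW C0)//.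
  have : V <= V / (s - t) by rewrite ler_pdivlMr// ler_piMr.
  have -> : n%:R * (2 * (V / (s - t))) = n%:R * 2 * (V / (s - t)) by rewrite mulrA.
  by move=> h; rewrite mulrDl mul1r lerD2r.
- apply: filterS ae => y h [Dy /ballE xy].
  have Oy : Om y by have [] := connected_component_sub Dy.
  by rewrite (h Oy) cutoff_in// tent_eq1// ltW.
- by apply: filterS ae => y h [Oy Dy]; rewrite (h Oy) cutoff_out.
Qed.

Lemma vol_open_gt0 (U : set 'rV[R]_n) y o L : open U -> U y ->
  0 < L -> U `<=` hbox o L -> 0 < vol U.
Proof.
move=> oU Uy L0 UL.
have /nbhs_ballP[r /= r0 yr] := open_nbhs_nbhs (conj oU Uy).
have r20 : 0 < r / 2 by rewrite divr_gt0.
apply: (@lt_le_trans _ _ (vol (hbox y (r / 2)))).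
  by rewrite vol_hbox ?exprn_gt0// ltW.
apply: vol_le.
- exact: measurable_hbox.
- exact: open_measurable_rV.
- apply: (vol_fin (ltW L0) _ UL); exact: open_measurable_rV.
- move=> v hv; apply: yr; split=> // i j; rewrite [i]ord1 /ball /= ltr_norml.
  by have := hv j; lra.
Qed.

Lemma measure_density Om : BV_extension_domain Om ->
  exists2 d : R, 0 < d & forall z p x rho s, 0 < s -> s <= 1 ->
  `|x - z| + s < rho -> closure (piece Om z rho p) x ->
  d * s ^+ n <= vol (piece Om z rho p `&` ball x s).
Proof.
move=> eOm; have [C C0 hC] := extension_of_cutoff eOm.
have oOm : open Om by have [[]] := eOm.
have [I I0 hI] := @isoperimetric R n n_gt1.
have K0 : 0 < I * C by rewrite mulr_gt0.
exists ((2 ^- n) ^+ n.-1 / (4 * (I * C)) ^+ n).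
  by rewrite divr_gt0 ?exprn_gt0 ?invr_gt0 ?exprn_gt0// mulr_gt0.
move=> z p x rho s s0 s1 xrho clx.
have oD := @open_piece Om z rho p oOm.
have sub t : piece Om z rho p `&` ball x t `<=` hbox (x - const_mx t) (2 * t).
  by move=> y [_ /ball_sub_hbox].
have oDt t : open (piece Om z rho p `&` ball x t).
  by apply: openI => //; exact: ball_open.
(* Membership in the closure gives positivity at every radius but no rate; the rate comes from
   [volume_growth]. *)
have pos t : 0 < t -> 0 < vol (piece Om z rho p `&` ball x t).
  move=> t0; have [y Dy] := clx _ (nbhsx_ballx x t t0).
  by apply: (@vol_open_gt0 _ y (x - const_mx t) (2 * t)) => //; rewrite mulr_gt0.
apply: (@volume_growth R n (I * C) s
  (fun t => vol (piece Om z rho p `&` ball x t))) => //.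
- by move=> t t0 _; exact: pos.
- move=> t t' t0 tt' _; apply: vol_le.
  + exact: open_measurable_rV.
  + exact: open_measurable_rV.
  + by apply: vol_ball_fin => //; exact: lt_le_trans tt'.
  + by apply: setIS; exact: le_ball.
- move=> t t' t0 tt' t's.
  have xt' : `|x - z| + t' < rho by apply: le_lt_trans xrho; rewrite lerD2l.
  have t1 : t' - t <= 1 by lra.
  have [w [iw fw tw w1 _]] := hC z p x rho t' t t0 tt' t1 xt'.
  have t20 : 0 < 2 * t by rewrite mulr_gt0.
  apply: le_trans (hI w _ _ _ iw fw t20 (oDt t) (sub t) (pos t t0) w1) _.
  apply: lerXn2r; rewrite ?nnegrE.
  + by rewrite mulr_ge0 ?(ltW I0)// tvr_ge0.
  + by rewrite !mulr_ge0 ?(ltW I0) ?(ltW C0) ?vol_ge0// invr_ge0 subr_ge0 ltW.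
  + by rewrite -!mulrA ler_wpM2l ?(ltW I0)// mulrA.
Qed.

(** In a cube of side 2s around each point both pieces have volume at least d s^n. [poincare] then
    gives d s^n <= P (2s) |Dw|, whence the constant d / (2P) and the power s^(n-1). *)
Lemma packing Om z rho p1 p2 : BV_extension_domain Om ->
  0 < rho -> rho <= 4 ->
  piece Om z rho p1 `&` piece Om z rho p2 = set0 ->
  exists c M s0 : R, [/\ 0 < c, 0 < s0 & forall s, 0 < s -> s <= s0 ->
    forall (k : nat) (f : 'I_k -> 'rV[R]_n),
    (forall i, [/\ closure (piece Om z rho p1) (f i),
       closure (piece Om z rho p2) (f i) & ball z (rho / 4) (f i)]) ->
    (forall i j, i != j -> 2 * s <= `|f i - f j|) ->
    k%:R * (c * s ^+ n.-1) <= M].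
Proof.
move=> eOm rho0 rho4 D12.
have oOm : open Om by have [[]] := eOm.
have [d d0 hd] := measure_density eOm.
have [C C0 hC] := extension_of_cutoff eOm.
have [P P0 hP] := @poincare R n n_gt1.
(* The cut-off is centred at [z] itself, with radii rho / 2 and 3/4 rho. Their difference rho / 4 is
   at most 1 because rho <= 4; with points within rho / 4 of [z] and s <= rho / 4, all the small
   cubes lie where w = 1 on the first piece. *)
have [w [iw fw _ w1 w0]] : exists w, [/\ mu.-integrable setT (EFin \o w),
    (total_variation w setT < +oo)%E,
    tvr w setT <= C * vol (piece Om z rho p1 `&` ball z (3 / 4 * rho)) /
      (3 / 4 * rho - rho / 2),
    ae_eq mu (piece Om z rho p1 `&` ball z (rho / 2)) w (cst 1) &
    ae_eq mu (Om `\` piece Om z rho p1) w (cst 0)].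
  by apply: hC; rewrite ?subrr ?normr0; lra.
pose s0 := Num.min 1 (rho / 4).
have s00 : 0 < s0 by rewrite lt_min ltr01 divr_gt0.
exists (d / (P * 2)), (tvr w setT), s0; split => //.
  by rewrite divr_gt0// mulr_gt0.
move=> s sp ss0 k f Af sep.
have [s1 s4] : s <= 1 /\ s <= rho / 4.
  by move: ss0; rewrite /s0 le_min => /andP[].
have low i : d / (P * 2) * s ^+ n.-1 <= tvr w (ball (f i) s).
  have [cl1 cl2 /ballE zf] := Af i.
  have fz : `|f i - z| < rho / 4 by rewrite distrC.
  have frho : `|f i - z| + s < rho by lra.
  have a0 : 0 < d * s ^+ n by rewrite mulr_gt0// exprn_gt0.
  have L0 : 0 < 2 * s by rewrite mulr_gt0.
  have o1 : open (piece Om z rho p1 `&` ball (f i) s).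
    by apply: openI; [exact: open_piece|exact: ball_open].
  have o2 : open (piece Om z rho p2 `&` ball (f i) s).
    by apply: openI; [exact: open_piece|exact: ball_open].
  have h1 : ae_eq mu (piece Om z rho p1 `&` ball (f i) s) w (cst 1).
    apply: filterS w1 => y h [D1y /ballE fy]; apply: h; split=> //; apply/ballE.
    have -> : z - y = (z - f i) + (f i - y) by rewrite addrA subrK.
    by apply: le_lt_trans (ler_normD _ _) _; lra.
  have h2 : ae_eq mu (piece Om z rho p2 `&` ball (f i) s) w (cst 0).
    apply: filterS w0 => y h [D2y _]; apply: h; split.
      by have [] := connected_component_sub D2y.
    move=> D1y; suff : set0 y by [].
    by rewrite -D12; split.
  have := hP w _ _ (f i - const_mx s) (2 * s) (d * s ^+ n) iw fw L0 o1 o2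
    (fun y h => @ball_sub_hbox _ _ _ _ y h.2) (fun y h => @ball_sub_hbox _ _ _ _ y h.2)
    a0 (hd z p1 (f i) rho s sp s1 frho cl1) (hd z p2 (f i) rho s sp s1 frho cl2) h1 h2.
  rewrite -ball_eq_obox// -[in X in d * X](prednK (ltnW n_gt1)) exprSr => h.
  rewrite mulrAC ler_pdivrMr ?mulr_gt0// -(ler_pM2r sp).
  by move: h; move: (tvr _ _) (s ^+ n.-1) => a b; nra.
apply: (@le_trans _ _ (\sum_(i < k) tvr w (ball (f i) s))).
  rewrite -[k in k%:R]card_ord mulr_natl -sumr_const.
  by apply: ler_sum => i _; exact: low.
apply: (tvr_superadditive iw fw) => // i j y /ballE fiy /ballE fjy.
apply/eqP/negP => /negP /sep; apply/negP; rewrite -ltNge.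
have -> : f i - f j = (f i - y) + (y - f j) by rewrite addrA subrK.
apply: le_lt_trans (ler_normD _ _) _; rewrite [`|y - _|]distrC; lra.
Qed.

End extension.

(** * Hausdorff measures and two-sided points *)

Section hausdorff_null.
Context {R : realType} {n : nat}.
Implicit Types (A E : set 'rV[R]_n) (x y z p : 'rV[R]_n).

Lemma enorm_le_norm x : enorm x <= n%:R * `|x|.
Proof.
apply: le_trans (enorm_le_sum _) _.
rewrite -[n in n%:R]card_ord mulr_natl -sumr_const; apply: ler_sum => i _.
rewrite [leRHS]/Num.norm /= mx_normrE.
exact: (le_bigmax _ (fun ij => `|x ij.1 ij.2|) (ord0, i)).
Qed.

Lemma norm_le_enorm x : `|x| <= enorm x.
Proof.
rewrite /Num.norm /= mx_normrE; apply: bigmax_le => [|[a b] _ /=].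
  exact: enorm_ge0.
by rewrite [a]ord1; exact: ler_enorm.
Qed.

Lemma ediam0 : ediam (set0 : set 'rV[R]_n) = 0%E.
Proof.
rewrite /ediam (_ : [set z | _] = [set 0%E]) ?ereal_sup1//.
by apply/seteqP; split => z /=; [case=> // -[x [y []]]|left].
Qed.

Lemma ediam_ge0 A : (0 <= ediam A)%E.
Proof. by apply: ereal_sup_ubound; left. Qed.

Lemma ediam_ball x (r : R) : 0 <= r ->
  (ediam (ball x r) <= (n%:R * (2 * r))%:E)%E.
Proof.
move=> r0; apply: ge_ereal_sup => _ [->|[y [z [/ballE xy /ballE xz ->]]]].
  by rewrite lee_fin !mulr_ge0.
rewrite lee_fin; apply: le_trans (enorm_le_norm _) _.
rewrite ler_wpM2l//.
have -> : y - z = (y - x) + (x - z) by rewrite addrA subrK.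
apply: le_trans (ler_normD _ _) _; rewrite [`|y - _|]distrC; lra.
Qed.

Lemma diam_pow_ge0 (s : R) E : (0 <= diam_pow s E)%E.
Proof. by rewrite /diam_pow; case: ifP => // _; exact: poweR_ge0. Qed.

Lemma diam_pow_ball (s : R) x (r : R) : 0 <= s -> 0 <= r ->
  (diam_pow s (ball x r) <= ((n%:R * (2 * r)) `^ s)%:E)%E.
Proof.
move=> s0 r0; rewrite /diam_pow; case: ifP => _; first by rewrite lee_fin powR_ge0.
rewrite -poweR_EFin gt0_ler_poweR ?in_itv//= ?leey ?ediam_ge0 ?ediam_ball//.
by rewrite lee_fin !mulr_ge0.
Qed.

(** Nullity for [hausdorff_measure s] stated directly through covers, a form in which countable
    unions are easy to treat. *)
Definition null_cover (s : R) A := forall d e : R, 0 < d -> 0 < e ->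
  exists E : (set 'rV[R]_n)^nat, [/\ A `<=` \bigcup_k E k,
    forall k, (ediam (E k) <= d%:E)%E &
    (\sum_(k <oo) diam_pow s (E k) <= e%:E)%E].

Lemma null_cover_hausdorff s A : null_cover s A -> hausdorff_measure s A = 0%E.
Proof.
move=> nA.
have h (d : R) : 0 < d -> hausdorff_premeasure s d A = 0%E.
  move=> d0; apply/eqP; rewrite eq_le; apply/andP; split.
    apply/lee_addgt0Pr => e e0; rewrite add0e.
    have [E [AE Ed Ee]] := nA d e d0 e0.
    by apply: le_trans Ee; apply: ereal_inf_lbound; exists E.
  apply: le_ereal_inf_tmp => _ [E _ <-].
  by apply: nneseries_ge0 => k _ _; exact: diam_pow_ge0.
apply/eqP; rewrite eq_le; apply/andP; split.
  by apply: ge_ereal_sup => _ [d d0 <-]; rewrite h.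
by apply: ereal_sup_ubound; exists 1 => /=; [exact: ltr01|rewrite h].
Qed.

Lemma null_cover_bigcup s (A : (set 'rV[R]_n)^nat) :
  (forall k, null_cover s (A k)) -> null_cover s (\bigcup_k A k).
Proof.
move=> nA d e d0 e0.
have /choice[E hE] k : exists E : (set 'rV[R]_n)^nat,
    [/\ A k `<=` \bigcup_i E i, forall i, (ediam (E i) <= d%:E)%E &
    (\sum_(i <oo) diam_pow s (E i) <= (e / (2 ^ k.+1)%:R)%:E)%E].
  by apply: nA => //; rewrite divr_gt0// ltr0n expn_gt0.
(* A bijection with pairs lists all the covers as one sequence; the shares e / 2^(k+1) sum to at
   most e. *)
have /card_esym/ppcard_eqP[f] := card_nat2.
exists (fun m => E (f m).1 (f m).2); split.
- move=> x [k _ Akx]; have [/(_ _ Akx)[i _ Ex] _ _] := hE k.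
  by exists (f^-1%FUN (k, i)) => //=; rewrite invK ?inE.
- by move=> m; have [_ /(_ (f m).2)] := hE (f m).1.
rewrite nneseries_esumT; last by move=> m; exact: diam_pow_ge0.
have := @reindex_esum R _ _ [set: nat] [set: nat * nat] f
  (fun q => diam_pow s (E q.1 q.2)) (bij).
move=> <-.
have -> : [set: nat * nat] = [set: nat] `*`` (fun=> [set: nat]).
  by apply/seteqP; split => -[].
rewrite -(@esum_esum R _ _ [set: nat] (fun=> [set: nat])
  (fun i j => diam_pow s (E i j))); last by move=> *; exact: diam_pow_ge0.
apply: (@le_trans _ _ (\sum_(k <oo) (e / (2 ^ k.+1)%:R)%:E)%E); last first.
  by apply: epsilon_trick0; exact: ltW.
rewrite -nneseries_esumT; last by move=> k; apply: esum_ge0 => *; exact: diam_pow_ge0.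
apply: lee_nneseries => [k _ _|k _].
  by apply: esum_ge0 => *; exact: diam_pow_ge0.
have [_ _] := hE k; rewrite nneseries_esumT// => j; exact: diam_pow_ge0.
Qed.

Lemma null_cover0 s : null_cover s (set0 : set 'rV[R]_n).
Proof.
move=> d e d0 e0; exists (fun=> set0); split => //.
  by move=> _; rewrite ediam0 lee_fin ltW.
rewrite eseries0 ?lee_fin ?(ltW e0)// => k _ _.
by rewrite /diam_pow eqxx.
Qed.

Lemma null_cover_sub s A B : A `<=` B -> null_cover s B -> null_cover s A.
Proof.
move=> AB nB d e d0 e0; have [E [BE Ed Ee]] := nB d e d0 e0.
by exists E; split => //; exact: subset_trans BE.
Qed.

Lemma finite_nneseries_le (u : (\bar R)^nat) (k : nat) (b : R) : 0 <= b ->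
  (forall m, 0 <= u m)%E -> (forall m, (m < k)%N -> (u m <= b%:E)%E) ->
  (forall m, (k <= m)%N -> u m = 0%E) ->
  (\sum_(m <oo) u m <= (k%:R * b)%:E)%E.
Proof.
move=> b0 u0 uk u00; apply: lime_le; first exact: is_cvg_nneseries.
apply: nearW => N.
have : (\sum_(0 <= m < N) u m <= ((minn N k)%:R * b)%:E)%E.
  elim: N => [|N IH]; first by rewrite big_geq// min0n mul0r.
  rewrite big_nat_recr//=; have [kN|Nk] := leqP k N.
    rewrite u00// adde0; apply: le_trans IH _.
    by rewrite lee_fin ler_wpM2r// ler_nat !(minn_idPr _)// (leq_trans kN).
  apply: le_trans (leeD IH (uk _ Nk)) _.
  rewrite -EFinD lee_fin (minn_idPl (ltnW Nk)) (minn_idPl Nk).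
  by rewrite -natr1 mulrDl mul1r.
move=> /le_trans; apply.
by rewrite lee_fin ler_wpM2r// ler_nat geq_minr.
Qed.

(** A maximal 2s-separated family in [A] has at most M / (c s^(n-1)) points, and the balls of radius
    2s around them cover [A]. Their Euclidean diameters are at most 4ns, so the sum is a constant
    times s^(sigma - (n-1)), which tends to 0. *)
Lemma packing_null_cover A (c M s0 sigma : R) : (0 < n)%N -> 0 < c -> 0 < s0 ->
  n.-1%:R < sigma ->
  (forall s, 0 < s -> s <= s0 -> forall (k : nat) (f : 'I_k -> 'rV[R]_n),
    (forall i, A (f i)) -> (forall i j, i != j -> 2 * s <= `|f i - f j|) ->
    k%:R * (c * s ^+ n.-1) <= M) ->
  null_cover sigma A.
Proof.
move=> n0 c0 s00 sig pack d e d0 e0.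
have sig0 : 0 <= sigma by apply: le_trans (ltW sig); rewrite ler0n.
pose a := sigma - n.-1%:R; have a0 : 0 < a by rewrite subr_gt0.
have nR : 0 < n%:R :> R by rewrite ltr0n.
pose C := M / c * (n%:R * 4) `^ sigma.
(* The empty family satisfies the packing bound. *)
have M0 : 0 <= M.
  have := pack s0 s00 (lexx _) 0 (fun=> 0); rewrite mul0r; apply.
    by case.
  by case.
have C0 : 0 <= C by rewrite mulr_ge0 ?powR_ge0// divr_ge0// ltW.
have C1 : 0 < C + 1 by rewrite ltr_wpDl.
near (0 : R)^'+ => s.
have sp : 0 < s by near: s; exact: nbhs_right_gt.
have ss0 : s <= s0 by near: s; exact: nbhs_right_le.
have sd : s <= d / (n%:R * 4).
  by near: s; apply: nbhs_right_le; rewrite divr_gt0// mulr_gt0.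
have se : s `^ a <= e / (C + 1).
  near: s; apply: (cvgr_le _ (powR_cvg0 a0)).
  by rewrite divr_gt0.
have p0 : 0 < c * s ^+ n.-1 by rewrite mulr_gt0// exprn_gt0.
pose P (k : nat) := `[< exists f : 'I_k -> 'rV[R]_n, (forall i, A (f i)) /\
  (forall i j, i != j -> 2 * s <= `|f i - f j|) >].
have P0 : exists k, P k.
  by exists 0%N; apply/asboolP; exists (fun=> 0); split => -[].
have Pb k : P k -> (k <= Num.trunc (M / (c * s ^+ n.-1)))%N.
  move=> /asboolP[f [Af sf]]; have := pack s sp ss0 k f Af sf.
  rewrite -ler_pdivlMr// => h; rewrite -ltnS -(ltr_nat R).
  by apply: le_lt_trans h _; exact: truncnS_gt.
case: (ex_maxnP P0 Pb) => k /asboolP[f [Af sf]] kmax.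
pose E (m : nat) : set 'rV[R]_n := if insub m is Some i then ball (f i) (2 * s) else set0.
have s20 : 0 <= 2 * s by rewrite mulr_ge0// ltW.
exists E; split.
- move=> x Ax; apply: contrapT => nx.
  have far i : 2 * s <= `|f i - x|.
    rewrite leNgt; apply/negP => /ballE fx; apply: nx; exists i => //.
    by rewrite /E valK.
  (* An uncovered point could be added to the family, against its maximality. *)
  suff /kmax : P k.+1 by rewrite ltnn.
  apply/asboolP; exists (fun i => if unlift ord_max i is Some j then f j else x).
  split=> [i|i j]; first by case: unlift.
  case: (unliftP ord_max i) => [i'|] ->; case: (unliftP ord_max j) => [j'|] ->.
  + by rewrite (inj_eq lift_inj); exact: sf.
  + by move=> _; exact: far.
  + by move=> _; rewrite distrC; exact: far.
  + by rewrite eqxx.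
- move=> m; rewrite /E; case: insubP => [i _ _|_]; last first.
    by rewrite ediam0 lee_fin ltW.
  apply: le_trans (ediam_ball _ s20) _; rewrite lee_fin.
  have -> : n%:R * (2 * (2 * s)) = s * (n%:R * 4) by ring.
  by rewrite -ler_pdivlMr// mulr_gt0.
pose b := (n%:R * (2 * (2 * s))) `^ sigma.
apply: (@le_trans _ _ (k%:R * b)%:E).
  apply: finite_nneseries_le; first exact: powR_ge0.
  - by move=> m; exact: diam_pow_ge0.
  - move=> m mk; rewrite /E insubT; exact: diam_pow_ball.
  - move=> m km; rewrite /E insubN -?leqNgt//.
    by rewrite /diam_pow eqxx.
rewrite lee_fin.
have bE : b = (n%:R * 4) `^ sigma * (s ^+ n.-1 * s `^ a).
  rewrite /b (_ : n%:R * (2 * (2 * s)) = n%:R * 4 * s); last by ring.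
  have n40 : 0 <= n%:R * 4 :> R by rewrite mulr_ge0.
  rewrite (powRM _ n40 (ltW sp)); congr (_ * _).
  rewrite -powR_mulrn ?(ltW sp)// -powRD; last by rewrite (gt_eqF sp) implybT.
  by congr (_ `^ _); rewrite /a addrC subrK.
have kM : k%:R * s ^+ n.-1 <= M / c.
  rewrite ler_pdivlMr// -mulrA [_ * c]mulrC.
  exact: (pack s sp ss0 k f Af sf).
have -> : k%:R * b = (k%:R * s ^+ n.-1) * (n%:R * 4) `^ sigma * s `^ a.
  by rewrite bE; ring.
apply: (@le_trans _ _ (C * (e / (C + 1)))).
  apply: ler_pM => //; rewrite ?powR_ge0//.
    by rewrite !mulr_ge0 ?powR_ge0// exprn_ge0// ltW.
  by rewrite ler_wpM2r// powR_ge0.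
by rewrite mulrA ler_pdivrMr// mulrC ler_wpM2l ?(ltW e0)// lerDl.
Unshelve. all: by end_near. Qed.

End hausdorff_null.

(** * Countable cover of the two-sided points *)

Section two_sided_cover.
Context {R : realType} {n : nat}.
Implicit Types (x y z p : 'rV[R]_n) (Om U : set 'rV[R]_n).

Definition rat_point (q : 'rV[rat]_n) : 'rV[R]_n := \row_i ratr (q ord0 i).

Lemma rat_point_dense U x : open U -> U x -> exists q, U (rat_point q).
Proof.
move=> oU Ux; have /nbhs_ballP[e /= e0 xe] := open_nbhs_nbhs (conj oU Ux).
have /choice[q hq] (i : 'I_n) : exists q : rat, `|x ord0 i - ratr q| < e.
  have [|q] := @rat_in_itvoo R (x ord0 i - e) (x ord0 i + e); first by lra.
  by rewrite in_itv /= => qe; exists q; rewrite ltr_norml; lra.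
exists (\row_i q i); apply: xe; split=> // i j; rewrite [i]ord1 !mxE.
exact: hq.
Qed.

Definition junction_index := ('rV[rat]_n * nat * 'rV[rat]_n * 'rV[rat]_n)%type.

Definition radius (k : nat) : R := k.+1%:R^-1.

(** Disjointness of the pieces is part of membership, so an index naming overlapping pieces gives
    the empty set. A piece is named by a rational point in it, and the indices form a countable
    type. *)
Definition junction Om (q : junction_index) : set 'rV[R]_n :=
  let: (z, k, p1, p2) := q in
  let D1 := piece Om (rat_point z) (radius k) (rat_point p1) in
  let D2 := piece Om (rat_point z) (radius k) (rat_point p2) in
  [set x | [/\ D1 `&` D2 = set0, closure D1 x, closure D2 x &
               ball (rat_point z) (radius k / 4) x]].

(** A cube around a rational point near x is squeezed between the Euclidean balls of radii s and r
    around x. Its component meeting [Om1 s] lies in [Om1 r], and likewise for [Om2], so disjointness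
    at radius r passes to the pieces. *)
Lemma two_sided_junction Om x : (0 < n)%N -> open Om -> two_sided Om x ->
  exists q, junction Om q x.
Proof.
move=> n0 oOm [_ [r0 [Om1 [Om2 [r00 comp nest]]]]].
have nR : 1 <= n%:R :> R by rewrite ler1n.
(* Points of the cube are within 2 rho of x in the sup norm, hence within 2 n rho in the Euclidean
   norm; this has to stay below r = r0 / 2. *)
have [k hk] : exists k, radius k < r0 / 2 / (2 * n%:R).
  have p0 : 0 < r0 / 2 / (2 * n%:R) by rewrite !divr_gt0// mulr_gt0// ltr0n.
  have [k _ /(_ k (leqnn k)) /= h] := near_infty_natSinv_lt (PosNum p0).
  by exists k.
set rho := radius k in hk.
have rho0 : 0 < rho by rewrite invr_gt0.
have nrho : n%:R * (2 * rho) < r0 / 2.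
  by move: hk; rewrite ltr_pdivlMr ?mulr_gt0 ?ltr0n//; lra.
have rho_r : rho < r0 / 2 by apply: le_lt_trans nrho; nra.
have [z zx] : exists z : 'rV[rat]_n, ball x (rho / 4) (rat_point z).
  by apply: (@rat_point_dense _ x); [exact: ball_open|apply: ballxx; rewrite divr_gt0].
have {}zx : `|rat_point z - x| < rho / 4 by move/ballE: zx; rewrite distrC.
pose r := r0 / 2; have rr : 0 < r < r0 by rewrite /r; apply/andP; split; lra.
pose s := rho / 2; have ss : 0 < s < r0 by rewrite /s; apply/andP; split; lra.
have [c1 c2 d12] := comp r rr.
have [e1 e2 _] := comp s ss.
have [sub1 sub2] : Om1 s `<=` Om1 r /\ Om2 s `<=` Om2 r.
  by apply: nest; rewrite /s /r; lra.
pose B := ball (rat_point z) rho.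
have Bin y : B y -> eball x r y.
  move=> /ballE zy; rewrite /eball /=; apply: le_lt_trans (enorm_le_norm _) _.
  apply: lt_trans nrho; rewrite ltr_pM2l ?ltr0n//.
  have -> : y - x = (y - rat_point z) + (rat_point z - x) by rewrite addrA subrK.
  apply: le_lt_trans (ler_normD _ _) _; rewrite [`|y - _|]distrC; lra.
have inB y : eball x s y -> B y.
  rewrite /eball /= => xy; apply/ballE.
  have h : `|x - y| < rho / 2 by rewrite distrC; apply: le_lt_trans (norm_le_enorm _) xy.
  have -> : rat_point z - y = (rat_point z - x) + (x - y) by rewrite addrA subrK.
  by apply: le_lt_trans (ler_normD _ _) _; lra.
have oB : open (Om `&` B) by apply: openI => //; exact: ball_open.
have side (O : R -> set 'rV[R]_n) : is_component (Om `&` eball x r) (O r) ->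
    is_component (Om `&` eball x s) (O s) -> O s `<=` O r ->
    (forall t, 0 < t -> t < r0 -> is_component (Om `&` eball x t) (O t)) ->
    (forall t t', 0 < t -> t < t' -> t' < r0 -> O t `<=` O t') ->
    exists p : 'rV[rat]_n, piece Om (rat_point z) rho (rat_point p) `<=` O r /\
      closure (piece Om (rat_point z) rho (rat_point p)) x.
  move=> [a Oa OrE] [b Ob OsE] Osr Oc On.
  have Osb : O s b by rewrite OsE; exact: connected_component_refl.
  have Bb : (Om `&` B) b by split; [exact: Ob.1|exact: inB Ob.2].
  pose D := connected_component (Om `&` B) b.
  have oD : open D by exact: open_connected_component.
  have Db : D b by exact: connected_component_refl.
  have [p Dp] := rat_point_dense oD Db.
  have DE : piece Om (rat_point z) rho (rat_point p) = D.
    by rewrite /piece -/B -(same_connected_component Dp).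
  exists p; rewrite DE; split.
    have := Osr _ Osb; rewrite OrE => rb.
    rewrite (same_connected_component rb).
    apply: connected_component_max => //; last exact: component_connected.
    by move=> y /connected_component_sub[Oy /Bin].
  move=> V /nbhs_ballP[e /= e0 xe].
  (* Here nestedness enters: the component at the smaller radius t contains a point e-close to x,
     and being inside [O s] it belongs to [D]. This puts x in the closure of [D]. *)
  pose t := Num.min s e / 2.
  have m0 : 0 < Num.min s e by rewrite lt_min e0 andbT; case/andP: ss.
  have t0 : 0 < t by rewrite divr_gt0.
  have tm : t < Num.min s e by rewrite /t; lra.
  have /andP[ts te] : (t < s) && (t < e) by rewrite -lt_min.
  have tr0 : t < r0 by apply: lt_trans ts _; case/andP: ss.
  have [v Ov OtE] := Oc t t0 tr0.
  exists v; split.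
    have Otv : O t v by rewrite OtE; exact: connected_component_refl.
    have : O s v by apply: On Otv => //; case/andP: ss.
    rewrite OsE; apply: connected_component_max => //.
      by apply: connected_component_sym; rewrite -OsE.
    - by move=> y /connected_component_sub[Oy /inB].
    - exact: component_connected.
  apply: xe; apply/ballE; rewrite distrC.
  by apply: le_lt_trans (norm_le_enorm _) _; apply: lt_trans te; case: Ov.
have [p1 [D1 cl1]] := side Om1 c1 e1 sub1
  (fun t t0 t1 => let: And3 h _ _ := comp t (introT andP (conj t0 t1)) in h)
  (fun t t' t0 tt t1 => (nest t t' t0 tt t1).1).
have [p2 [D2 cl2]] := side Om2 c2 e2 sub2
  (fun t t0 t1 => let: And3 _ h _ := comp t (introT andP (conj t0 t1)) in h)
  (fun t t' t0 tt t1 => (nest t t' t0 tt t1).2).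
exists (z, k, p1, p2); split => //; last by apply/ballE.
by rewrite -subset0 -d12 => y [/D1 h1 /D2 h2].
Qed.

End two_sided_cover.

Theorem theorem1p3 (R : realType) (n : nat) (Omega : set 'rV[R]_n) :
  (2 <= n)%N -> BV_extension_domain Omega ->
  (hausdorff_dim (two_sided Omega) <= (n%:R - 1)%:E)%E.
Proof.
move=> n2 ext; have n0 : (0 < n)%N := ltnW n2.
have oOm : open Omega by have [[]] := ext.
have nE : n.-1%:R = n%:R - 1 :> R by rewrite -{2}(prednK n0) -natr1 addrK.
(* The packing bound gives nullity for each exponent above n - 1, and the infimum of these exponents
   is n - 1. *)
apply/lee_addgt0Pr => e e0; rewrite -EFinD.
apply: ereal_inf_lbound; exists (n%:R - 1 + e) => //=.
split; first by rewrite -nE addr_ge0// ?ler0n ?ltW.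
apply: null_cover_hausdorff.
pose A (m : nat) : set 'rV[R]_n :=
  if unpickle m is Some q then junction Omega q else set0.
apply: (@null_cover_sub _ _ _ _ (\bigcup_m A m)).
  move=> x /(two_sided_junction n0 oOm)[q qx].
  exists (pickle q); first exact: I.
  rewrite /A pickleK; exact: qx.
apply: null_cover_bigcup => m; rewrite /A.
case: unpickle => [[[[z k] p1] p2]|]; last exact: null_cover0.
have [D12|D12] := pselect (piece Omega (rat_point z) (radius k) (rat_point p1) `&`
  piece Omega (rat_point z) (radius k) (rat_point p2) = (set0 : set 'rV[R]_n)); last first.
  by apply: null_cover_sub (@null_cover0 R n _) => x [].
have rho0 : 0 < radius k :> R by rewrite invr_gt0.
have rho4 : radius k <= 4 :> R.
  by apply: (@le_trans _ _ 1); [rewrite invf_le1// ler1n|lra].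
have [c [M [s0 [c0 s00 pack]]]] := packing n2 ext rho0 rho4 D12.
apply: (packing_null_cover n0 c0 s00 (M := M)); first by rewrite nE ltrDl.
move=> s sp ss0 k' f fA sep; apply: (pack s sp ss0 k' f) => // i.
by have [] := fA i.
Qed.
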